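(* Let $n\ge 1$ and let $f\colon\mathbb{R}\to\mathbb{R}$ be locally Lipschitz continuous and non-decreasing with $f(0)=0$. Put $L(s)=\sup\left\{\frac{f(u)-f(v)}{u-v}: |u|,|v|\le s,\ u\ne v\right\}$ for $s>0$, $L(0)=0$, and suppose that $$\int_1^\infty s^{-(1+2/n)}L(s)\,ds<\infty .$$ Let $\phi,\psi\in L^1(\mathbb{R}^n)$ and let $u(t;\phi)$ and $u(t;\psi)$ be the maximal classical $L^1$-solutions of $u_t=\Delta u+f(u)$ with initial data $\phi$ and $\psi$, defined on $[0,T_{\rm max}(\phi))$ and $[0,T_{\rm max}(\psi))$ respectively. (a) (Continuous dependence.) There exist $\tau=\tau(\phi,\psi)>0$ (with both solutions defined on $(0,\tau]$) and a continuous, non-negative function $q(t)$ satisfying $q(t)\to0$ as $t\to0$, such that for all $t\in(0,\tau]$, $$\|u(t;\phi)-u(t;\psi)\|_1+t^{n/2}\|u(t;\phi)-u(t;\psi)\|_\infty\le 2\|\phi-\psi\|_1e^{q(t)} .$$ (b) (Comparison.) If $\phi\le\psi$ then $u(t;\phi)\le u(t;\psi)$ on $[0,T)$ for all $T\le\min\{T_{\rm max}(\phi),T_{\rm max}(\psi)\}$. In particular, if $\phi\ge0$ then $u(t;\phi)\ge0$ on $[0,T_{\rm max}(\phi))$.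
   Context: $\|\cdot\|_q$ denotes the norm of $L^q(\mathbb{R}^n)$; inequalities between elements of $L^1(\mathbb{R}^n)$ are a.e. For $T>0$ set $Q_T=\mathbb{R}^n\times(0,T)$. A function $u$ is a classical $L^1$-solution of $u_t=\Delta u+f(u)$, $u(0)=\phi\in L^1(\mathbb{R}^n)$, on $[0,T)$ if $u$ satisfies the equation in the classical sense in $Q_T$ (i.e. $u\in C^{2,1}(Q_T)$ and the equation holds pointwise), $u\in C([0,T),L^1(\mathbb{R}^n))\cap L^\infty_{\rm loc}((0,T),L^\infty(\mathbb{R}^n))$, and $u(0)=\phi$. Under the stated hypotheses on $f$, for every $\phi\in L^1(\mathbb{R}^n)$ there is a unique maximal classical $L^1$-solution $u(t;\phi)$: there is $T_{\rm max}(\phi)\in(0,\infty]$ such that $u(t;\phi)$ is the unique classical $L^1$-solution on $[0,T_{\rm max}(\phi))$ and, if $T_{\rm max}(\phi)<\infty$, it cannot be continued to a classical $L^1$-solution on $[0,\tau)$ for any $\tau>T_{\rm max}(\phi)$. *)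

(* Defs.v *)
From HB Require Import structures.
From mathcomp Require Import all_boot all_order all_algebra.
From mathcomp Require Import all_classical all_reals all_analysis.

Set Implicit Arguments.
Unset Strict Implicit.
Unset Printing Implicit Defensive.

Import Order.TTheory GRing.Theory Num.Theory.
Import numFieldNormedType.Exports.

Local Open Scope classical_set_scope.
Local Open Scope ring_scope.

(* 'rV[R]_n carries the product of the Borel sigma-algebras of R: it is
   generated by the coordinates, and coincides with the Borel sigma-algebra of
   the topology of 'rV[R]_n. *)

Definition rV_display : measure_display.
Proof. exact: default_measure_display. Qed.

Section measurable_rV.
Context {R : realType} {n : nat}.

Definition rV_coord (i : 'I_n) (x : 'rV[R]_n) : R := x 0 i.

Let rV_set0 : g_sigma_preimage rV_coord set0.
Proof. exact: sigma_algebra0. Qed.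

Let rV_setC A : g_sigma_preimage rV_coord A -> g_sigma_preimage rV_coord (~` A).
Proof. exact: sigma_algebraC. Qed.

Let rV_bigcup (F : (set 'rV[R]_n)^nat) :
  (forall i, g_sigma_preimage rV_coord (F i)) ->
  g_sigma_preimage rV_coord (\bigcup_i (F i)).
Proof. exact: sigma_algebra_bigcup. Qed.

HB.instance Definition _ := @isMeasurable.Build rV_display 'rV[R]_n
  (g_sigma_preimage rV_coord) rV_set0 rV_setC rV_bigcup.

Lemma measurable_rV_coord i : measurable_fun [set: 'rV[R]_n] (rV_coord i).
Proof.
move=> _ Y mY; rewrite setTI; apply: sub_sigma_algebra => /=.
rewrite -bigcup_seq/=; exists i => /=; first by rewrite mem_index_enum.
by exists Y => //; rewrite setTI.
Qed.

Lemma measurable_fun_rVP d (T : measurableType d) (g : T -> 'rV[R]_n) :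
  measurable_fun [set: T] g <->
  forall i, measurable_fun [set: T] (rV_coord i \o g).
Proof.
split=> [mg i|mg]; first exact: measurableT_comp (measurable_rV_coord i) mg.
have sub : g_sigma_preimage rV_coord `<=` [set B | measurable (g @^-1` B)].
  apply: smallest_sub.
    split => /=; first by rewrite preimage_set0.
      by move=> A mA; rewrite setTD -preimage_setC; exact: measurableC.
    by move=> F mF; rewrite preimage_bigcup; exact: bigcup_measurable.
  rewrite -bigcup_seq => B [i _ [A mA <-]] /=.
  by rewrite setTI -comp_preimage -[X in measurable X]setTI; exact: mg.
by move=> _ A mA; rewrite setTI; exact: sub.
Qed.

End measurable_rV.

Section lebesgue_rV.
Context {R : realType}.

Definition cons_rV n (z : R * 'rV[R]_n) : 'rV[R]_n.+1 :=
  \row_i oapp (z.2 0) z.1 (unlift 0 i).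

Definition uncons_rV n (x : 'rV[R]_n.+1) : R * 'rV[R]_n :=
  (x 0 0, \row_i x 0 (lift 0 i)).

Lemma cons_rV0 n (z : R * 'rV[R]_n) : cons_rV z 0 0 = z.1.
Proof. by rewrite mxE unlift_none. Qed.

Lemma cons_rVS n (z : R * 'rV[R]_n) i : cons_rV z 0 (lift 0 i) = z.2 0 i.
Proof. by rewrite mxE liftK. Qed.

Lemma cons_rVK n : cancel (@cons_rV n) (@uncons_rV n).
Proof.
move=> [a x]; congr pair; first by rewrite cons_rV0.
by apply/rowP => i; rewrite mxE cons_rVS.
Qed.

Lemma measurable_cons_rV n :
  measurable_fun [set: measurableTypeR R * 'rV[R]_n] (@cons_rV n).
Proof.
apply/measurable_fun_rVP => i; case: (unliftP 0 i) => [j ->|->].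
- rewrite (_ : _ \o _ = rV_coord j \o snd).
    exact: measurableT_comp (measurable_rV_coord j) measurable_snd.
  by apply/funext => z; exact: cons_rVS.
- rewrite (_ : _ \o _ = fst); first exact: measurable_fst.
  by apply/funext => z; exact: cons_rV0.
Qed.

Lemma measurable_uncons_rV n :
  measurable_fun [set: 'rV[R]_n.+1]
    (@uncons_rV n : _ -> measurableTypeR R * 'rV[R]_n).
Proof.
apply/measurable_fun_pairP; split; first exact: (measurable_rV_coord 0).
apply/measurable_fun_rVP => i.
rewrite (_ : _ \o _ = rV_coord (lift 0 i)); first exact: measurable_rV_coord.
by apply/funext => x; rewrite /= /rV_coord mxE.
Qed.

Section lebesgue_cons.
Variables (n : nat) (m : {sigma_finite_measure set 'rV[R]_n -> \bar R}).

Definition lebesgue_cons : set 'rV[R]_n.+1 -> \bar R :=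
  pushforward (lebesgue_measure \x m)%E (@cons_rV n).

Let lebesgue_cons0 : lebesgue_cons set0 = 0%E.
Proof. by rewrite /lebesgue_cons measure0//; exact: measurable_cons_rV. Qed.

Let lebesgue_cons_ge0 A : (0 <= lebesgue_cons A)%E.
Proof. by apply: measure_ge0; exact: measurable_cons_rV. Qed.

Let lebesgue_cons_sigma_additive : semi_sigma_additive lebesgue_cons.
Proof. by apply: measure_semi_sigma_additive; exact: measurable_cons_rV. Qed.

HB.instance Definition _ := isMeasure.Build _ _ _ lebesgue_cons
  lebesgue_cons0 lebesgue_cons_ge0 lebesgue_cons_sigma_additive.

Let lebesgue_cons_sigma_finite : sigma_finite setT lebesgue_cons.
Proof.
have /sigma_finiteP[F [FT ndF Foo]] := sigma_finiteT (@lebesgue_measure R).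
have /sigma_finiteP[G [GT ndG Goo]] := sigma_finiteT m.
exists (fun k => @uncons_rV n @^-1` (F k `*` G k)).
  rewrite -preimage_bigcup (_ : \bigcup_i _ = setT) ?preimage_setT//.
  rewrite -setXTT FT GT; apply/esym/seteqP; split=> -[x y] /=.
    move=> [[k _ Fkx] [l _ Gly]]; exists (maxn k l) => //; split.
    - by move: x Fkx; exact/subsetPset/ndF/leq_maxl.
    - by move: y Gly; exact/subsetPset/ndG/leq_maxr.
  by move=> [k _ []/= ? ?]; split; exists k.
move=> k; have [mF Fk] := Foo k; have [mG Gk] := Goo k; split.
  rewrite -[X in measurable X]setTI; apply: measurable_uncons_rV => //.
  exact: measurableX.
rewrite /lebesgue_cons /pushforward -comp_preimage.
rewrite (_ : _ \o _ = id) ?preimage_id; last by apply/funext; exact: cons_rVK.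
by rewrite product_measure1E// lte_mul_pinfty// ge0_fin_numE.
Qed.

HB.instance Definition _ := Measure_isSigmaFinite.Build _ _ _ lebesgue_cons
  lebesgue_cons_sigma_finite.

End lebesgue_cons.

Fixpoint lebesgue_rV n : {sigma_finite_measure set 'rV[R]_n -> \bar R} :=
  if n is k.+1 then lebesgue_cons (lebesgue_rV k) else \d_(0 : 'rV[R]_0).

Lemma measurable_box n (A : 'I_n -> set R) : (forall i, measurable (A i)) ->
  measurable [set x : 'rV[R]_n | forall i, A i (x 0 i)].
Proof.
move=> mA; rewrite (_ : mkset _ = \big[setI/setT]_(i < n) (rV_coord i @^-1` A i)).
  apply: bigsetI_measurable => i _; rewrite -[X in measurable X]setTI.
  by apply: (measurable_rV_coord i) => //; exact: mA.
rewrite -bigcap_seq; apply/seteqP; split=> x /= h i => [_|]; first exact: h.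
by apply: (h i) => /=; rewrite mem_index_enum.
Qed.

Lemma lebesgue_rV_box n (A : 'I_n -> set (measurableTypeR R)) :
  (forall i, measurable (A i)) ->
  lebesgue_rV n [set x | forall i, A i (x 0 i)] =
  (\prod_(i < n) lebesgue_measure (A i))%E.
Proof.
elim: n => [|n IHn] in A *.
  by move=> _; rewrite big_ord0 /= diracE mem_set// => -[].
move=> mA; rewrite big_ord_recl -IHn//.
pose B := [set x : 'rV[R]_n | forall i, A (lift 0 i) (x 0 i)].
have mB : measurable B by exact: (measurable_box (A := fun i => A (lift 0 i)) (fun i => mA _)).
rewrite -(product_measure1E lebesgue_measure (lebesgue_rV n) (mA 0) mB).
rewrite /= /lebesgue_cons /pushforward.
congr product_measure1; apply/seteqP; split=> -[a x] /=.
  move=> h; split=> [|i]; last by have := h (lift 0 i); rewrite cons_rVS.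
  by have := h 0; rewrite cons_rV0.
by move=> [h0 h] i; case: (unliftP 0 i) => [j ->|->];
  rewrite (cons_rVS, cons_rV0)//; exact: h.
Qed.

End lebesgue_rV.

Section semilinear_heat.
Context {R : realType}.

Definition lip_const (f : R -> R) (s : R) : R :=
  if 0 < s then
    sup [set y | exists u v, [/\ `|u| <= s, `|v| <= s, u != v &
                                 y = (f u - f v) / (u - v)]]
  else 0.

Context {n : nat}.
Local Notation mu := (@lebesgue_rV R n).
Implicit Types (T : \bar R) (f : R -> R) (phi : 'rV[R]_n -> R).
Implicit Types u v : R -> 'rV[R]_n -> R.

Definition Lq_norm (q : \bar R) (g : 'rV[R]_n -> R) : \bar R :=
  ('N[mu]_q [EFin \o g])%E.

Definition vec_e (i : 'I_n) : 'rV[R]_n := delta_mx 0 i.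

Definition laplacian (g : 'rV[R]_n -> R) (x : 'rV[R]_n) : R :=
  \sum_(i < n) 'D_(vec_e i) ('D_(vec_e i) g) x.

Definition cylinder T : set (R * 'rV[R]_n) :=
  [set z | 0 < z.1 /\ (z.1%:E < T)%E].

(* cylinder T is open, so that this is continuity of the restriction of w. *)
Definition continuous_on_cylinder T (w : R -> 'rV[R]_n -> R) : Prop :=
  forall z, cylinder T z -> {for z, continuous (fun z => w z.1 z.2)}.

Definition C21 T u : Prop :=
  [/\ continuous_on_cylinder T u,
      (forall z, cylinder T z -> derivable (u ^~ z.2) z.1 1) /\
        continuous_on_cylinder T (fun t x => derive1 (u ^~ x) t),
      (forall i,
        (forall z, cylinder T z -> derivable (u z.1) z.2 (vec_e i)) /\
        continuous_on_cylinder T (fun t => 'D_(vec_e i) (u t))) &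
      (forall i j,
        (forall z, cylinder T z ->
          derivable ('D_(vec_e j) (u z.1)) z.2 (vec_e i)) /\
        continuous_on_cylinder T
          (fun t => 'D_(vec_e i) ('D_(vec_e j) (u t))))].

(* A curve u in L^1 is given by representatives u t, so that statements about
   u t as an element of L^1 are almost everywhere ones. *)

Definition continuous_L1 T u : Prop :=
  forall t, 0 <= t -> (t%:E < T)%E ->
    u t \in Lfun mu 1%E /\
    Lq_norm 1%E (u s \- u t)
      @[s --> within [set s | 0 <= s /\ (s%:E < T)%E] (nbhs t)] --> 0%E.

Definition locally_bounded_Linfty T u : Prop :=
  forall a b : R, 0 < a -> a < b -> (b%:E < T)%E ->
    exists M : R, \forall t \ae (@lebesgue_measure R),
      a <= t <= b -> (Lq_norm +oo (u t) <= M%:E)%E.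

Definition classical_L1_solution f phi T u : Prop :=
  [/\ C21 T u,
      (forall z, cylinder T z ->
        derive1 (u ^~ z.2) z.1 = laplacian (u z.1) z.2 + f (u z.1 z.2)),
      continuous_L1 T u,
      locally_bounded_Linfty T u &
      \forall x \ae mu, u 0 x = phi x].

Definition maximal_classical_L1_solution f phi T u : Prop :=
  [/\ (0 < T)%E,
      classical_L1_solution f phi T u,
      (forall v, classical_L1_solution f phi T v ->
        forall t, 0 <= t -> (t%:E < T)%E -> \forall x \ae mu, v t x = u t x) &
      (T < +oo)%E -> forall tau v, (T < tau)%E ->
        classical_L1_solution f phi tau v ->
        ~ (forall t, 0 <= t -> (t%:E < T)%E ->
             \forall x \ae mu, v t x = u t x)].

End semilinear_heat.

(* Main.v *)
Require Import Defs.
From HB Require Import structures.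
From mathcomp Require Import all_boot all_order all_algebra.
From mathcomp Require Import all_classical all_reals all_analysis.
From mathcomp Require Import measurable_realfun ess_sup_inf ring lra.

(** The proof rests on one comparison. Let w be u, - u or the difference u - v
of two solutions. Where w is positive, w_t - Delta w <= kappa(t) w, where
kappa(t) is the Lipschitz constant of f on the range of the functions at time t.
If g >= 0, g >= w(a) and Q' = kappa, then exp(Q(t)) e^{(t-a) Delta} g is a
solution of z_t = Delta z + kappa z that starts above w, and the maximum
principle for bounded functions on R^n keeps w below it ([maximum_principle],
[heat_comparison]). The norms are then read off the Gaussian kernel: its
integral is 1, which controls the L^1 norm, and its maximum is at most t^(-n/2),
which controls the L^infinity norm. Each of the two terms in (a) is thus bounded
with the constant 1, whence the factor 2.

The integral condition on L makes kappa integrable up to time 0. Suppose that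
solutions are bounded by K t^(-n/2), so that kappa(t) = L(K t^(-n/2)). The
substitution s = K t^(-n/2) turns the integral of kappa over ]0, t[ into
(2/n) K^(2/n) times the integral of s^(-1-2/n) L(s) over [K t^(-n/2), oo[. This
is the function q of part (a), called [growth] below. As kappa may jump, Q is
not differentiable in general; but kappa is nonincreasing in t, so
kappa(t) (t - s) <= Q(t) - Q(s) for s <= t, and the maximum principle is proved
under this one-sided condition.

The bound |u(t)| <= K t^(-n/2) for small t ([apriori_bound]) comes from the
same comparison, started at a time a > 0 with g = |u(a)|. The comparison
function z = exp(Q) e^{(t-a) Delta} |u(a)| satisfies z <= K (t - a)^(-n/2) while
Q <= 1, if K = e M with M a bound of the L^1 norms near time 0; hence
f(z) <= kappa z, and z is a supersolution of the nonlinear equation itself. Since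
K and the length of the time interval do not depend on a, one may let a tend to
0.

Part (a) is the comparison for u - v and v - u with g = |u(a) - v(a)|, in the
limit where a tends to 0 ([continuous_dependence]). For part (b), g is the
positive part of u(a) - v(a), whose L^1 norm tends to 0 with a; at later times u
and v are bounded and kappa can be taken constant ([comparison]). Nonnegativity
is the comparison with the solution 0. *)

Set Implicit Arguments.
Unset Strict Implicit.
Unset Printing Implicit Defensive.

Import Order.TTheory GRing.Theory Num.Theory.
Import numFieldNormedType.Exports.

Local Open Scope classical_set_scope.
Local Open Scope ring_scope.

(** * The heat kernel *)

Section heat_kernel.
Context {R : realType}.

Definition sqnorm n (x : 'rV[R]_n) : R := \sum_(i < n) x 0 i ^+ 2.

(** The factor (4 pi s)^(-n/2), written with exp and ln so that it is visibly
multiplicative in n and easy to differentiate in s. *)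
Definition heat_peak (n : nat) (s : R) : R := expR (- (n%:R / 2 * ln (4 * pi * s))).

Definition heat n (s : R) (z : 'rV[R]_n) : R :=
  heat_peak n s * expR (- (sqnorm z / (4 * s))).

Lemma sqnorm_ge0 n (x : 'rV[R]_n) : 0 <= sqnorm x.
Proof. by apply: sumr_ge0 => i _; exact: sqr_ge0. Qed.

Lemma heat_ge0 n s (z : 'rV[R]_n) : 0 <= heat s z.
Proof. by apply: mulr_ge0; exact: expR_ge0. Qed.

Lemma heat_peak_gt0 n s : 0 < heat_peak n s.
Proof. exact: expR_gt0. Qed.

Lemma heat_le_peak n s (z : 'rV[R]_n) : 0 < s -> heat s z <= heat_peak n s.
Proof.
move=> s0; rewrite ler_piMr ?expR_ge0// -expR0 ler_expR oppr_le0.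
by rewrite divr_ge0 ?sqnorm_ge0// mulr_ge0// ltW.
Qed.

Lemma sqnormC n (x y : 'rV[R]_n) : sqnorm (x - y) = sqnorm (y - x).
Proof. by apply: eq_bigr => i _; rewrite !mxE -sqrrN opprB. Qed.

Lemma heatC n s (x y : 'rV[R]_n) : heat s (x - y) = heat s (y - x).
Proof. by rewrite /heat sqnormC. Qed.

(** In dimension one the kernel is the normal density of variance 2 s, whose
integral is known. *)
Lemma heat_normal s (m a : R) : 0 < s ->
  heat_peak 1 s * expR (- ((m - a) ^+ 2 / (4 * s))) = normal_pdf m (Num.sqrt (2 * s)) a.
Proof.
move=> s0; have p0 : 0 < pi :> R := pi_gt0 _.
have s20 : 0 < 2 * s by rewrite mulr_gt0.
rewrite normal_pdfE ?gt_eqF ?sqrtr_gt0// /normal_peak /normal_fun.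
rewrite sqr_sqrtr ?ltW//.
have -> : - (a - m) ^+ 2 / (2 * s *+ 2) = - ((m - a) ^+ 2 / (4 * s)).
  rewrite -mulr_natr; field; rewrite gt_eqF//.
have -> : 2 * s * pi *+ 2 = 4 * pi * s by rewrite -mulr_natr; ring.
have p4 : 0 < 4 * pi * s by rewrite mulr_gt0// mulr_gt0.
rewrite -powR12_sqrt ?(ltW p4)// -powRN /powR gt_eqF//.
by rewrite /heat_peak mul1r mulNr.
Qed.

(** The kernel is a product over the coordinates, which lets its integral be
computed by induction on the dimension. *)
Lemma heat_cons n s (x : 'rV[R]_n.+1) (z : R * 'rV[R]_n) :
  heat s (x - cons_rV z) =
  (heat_peak 1 s * expR (- ((x 0 0 - z.1) ^+ 2 / (4 * s)))) *
   heat s ((uncons_rV x).2 - z.2).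
Proof.
have e1 : heat_peak n.+1 s = heat_peak 1 s * heat_peak n s.
  rewrite /heat_peak -expRD -opprD -!mulrDl.
  by rewrite -[1%N%:R + _]natrD add1n.
have e2 : sqnorm (x - cons_rV z) =
    (x 0 0 - z.1) ^+ 2 + sqnorm ((uncons_rV x).2 - z.2).
  rewrite /sqnorm big_ord_recl/= !mxE unlift_none/=; congr (_ + _).
  by apply: eq_bigr => i _; rewrite !mxE liftK.
have gen (p q a b c : R) : p * q * expR (- ((a + b) / c)) =
    p * expR (- (a / c)) * (q * expR (- (b / c))).
  by rewrite mulrACA -expRD -opprD -mulrDl.
by rewrite /heat e1 e2 gen.
Qed.

Lemma measurable_sqnormB n (d : measure_display) (T : measurableType d)
    (a b : T -> 'rV[R]_n) :
  measurable_fun setT a -> measurable_fun setT b ->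
  measurable_fun setT (fun y => sqnorm (a y - b y)).
Proof.
move=> ma mb; apply: measurable_sum => i.
apply: measurable_funX; rewrite (_ : (fun _ => _) =
   (rV_coord i \o a) \- (rV_coord i \o b)); last first.
  by apply/funext => y; rewrite /rV_coord !mxE.
by apply: measurable_funB; exact: measurableT_comp (measurable_rV_coord i) _.
Qed.

Lemma measurable_heat n (d : measure_display) (T : measurableType d)
    (a b : T -> 'rV[R]_n) s :
  measurable_fun setT a -> measurable_fun setT b ->
  measurable_fun setT (fun y => heat s (a y - b y)).
Proof.
move=> ma mb; apply: measurable_funM => //.
apply: measurableT_comp => //; apply: measurableT_comp => //.
by apply: measurable_funM => //; exact: measurable_sqnormB.
Qed.

(** By induction on n: the measure of R^(n+1) is the image of a product measure,
and Tonelli's theorem separates the first coordinate. *)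
Lemma integral_heat n s (x : 'rV[R]_n) : 0 < s ->
  (\int[lebesgue_rV n]_y (heat s (x - y))%:E = 1)%E.
Proof.
move=> s0; elim: n x => [|n IHn] x.
  rewrite integral_dirac//; last first.
    by apply/measurable_EFinP; apply: measurable_heat.
  rewrite diracT mul1e /heat /heat_peak /sqnorm mul0r mul0r oppr0 expR0 big_ord0.
  by rewrite mul0r oppr0 expR0 mulr1.
rewrite /= ge0_integral_pushforward//=; last 3 first.
- exact: measurable_cons_rV.
- by apply/measurable_EFinP; apply: measurable_heat.
- by move=> y _; rewrite lee_fin heat_ge0.
rewrite preimage_setT fubini_tonelli1/=; last 2 first.
- apply/measurable_EFinP; apply: measurable_heat => //.
  exact: measurable_cons_rV.
- by move=> y; rewrite lee_fin heat_ge0.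
rewrite -[RHS](@integral_normal_pdf R (x 0 0) (Num.sqrt (2 * s))).
apply: eq_integral => a _; rewrite /fubini_F/=.
under eq_integral do rewrite heat_cons/= EFinM.
rewrite ge0_integralZl//; last 3 first.
- by apply/measurable_EFinP; apply: measurable_heat.
- by move=> y _; rewrite lee_fin heat_ge0.
- by rewrite lee_fin mulr_ge0 ?expR_ge0// ltW ?heat_peak_gt0.
by rewrite IHn mule1 heat_normal.
Qed.

(** Away from the origin half of the Gaussian exponent is at least r^2 / (8 s),
and the other half is the exponent of the kernel at time 2 s. Since that kernel
also has mass one, this shows the concentration of the kernel as s tends to 0
without integrating over the complement of a ball. *)
Lemma heat_tail n (s : R) (z : 'rV[R]_n) (r : R) : 0 < s -> r ^+ 2 <= sqnorm z ->
  heat s z <= expR (n%:R / 2 * ln 2) * expR (- (r ^+ 2 / (8 * s))) * heat (2 * s) z.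
Proof.
move=> s0 rz; rewrite /heat /heat_peak -!expRD ler_expR.
have -> : ln (4 * pi * (2 * s)) = ln 2 + ln (4 * pi * s) :> R.
  have p4 : 0 < 4 * pi * s by rewrite mulr_gt0// mulr_gt0// pi_gt0.
  by rewrite mulrCA (lnM (y := 4 * pi * s)) ?posrE.
set N := n%:R / 2; set l := ln 2; set l' := ln (_ * s).
have -> : sqnorm z / (4 * s) = 2 * (sqnorm z / (8 * s)) by field; rewrite gt_eqF.
have -> : sqnorm z / (4 * (2 * s)) = sqnorm z / (8 * s) by field; rewrite gt_eqF.
have : r ^+ 2 / (8 * s) <= sqnorm z / (8 * s).
  by rewrite ler_pM2r// invr_gt0 mulr_gt0.
move: (r ^+2 / _) (sqnorm z / _) => A B AB.
rewrite mulrDr; lra.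
Qed.

End heat_kernel.

Section heat_kernel_derivatives.
Context {R : realType}.

Lemma mulr_expRN_le1 (x : R) : x * expR (- x) <= 1.
Proof.
rewrite expRN ler_pdivrMr ?expR_gt0// mul1r.
by apply: le_trans (expR_ge1Dx x); rewrite lerDr.
Qed.

Lemma heat_peak_le n (s t : R) : 0 < s -> s <= t -> heat_peak n t <= heat_peak n s.
Proof.
move=> s0 st; have t0 := lt_le_trans s0 st.
rewrite ler_expR lerN2 ler_wpM2l ?divr_ge0// ler_ln ?posrE ?mulr_gt0 ?pi_gt0//.
by rewrite ler_wpM2l// ltW// mulr_gt0 ?pi_gt0.
Qed.

(** This is x exp(- x) <= 1 for x = |z|^2 / (4 s). Each derivative of the kernel
used below is the kernel times a polynomial of degree at most two in z, and is
therefore bounded. *)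
Lemma sqnorm_heat_le n (s : R) (z : 'rV[R]_n) : 0 < s ->
  sqnorm z * heat s z <= 4 * s * heat_peak n s.
Proof.
move=> s0; have s40 : 0 < 4 * s by rewrite mulr_gt0.
rewrite /heat mulrCA [4 * s * _]mulrC ler_pM2l ?heat_peak_gt0//.
set x := sqnorm z / _.
have -> : sqnorm z = 4 * s * x by rewrite /x mulrC divfK// gt_eqF.
by rewrite -(mulrA (4 * s)) -[leRHS]mulr1 ler_pM2l// mulr_expRN_le1.
Qed.

Lemma sqr_coord_le n (z : 'rV[R]_n) i : z 0 i ^+ 2 <= sqnorm z.
Proof.
rewrite /sqnorm (bigD1 i)//= lerDl; apply: sumr_ge0 => j _; exact: sqr_ge0.
Qed.

Lemma sqnorm_line n (z : 'rV[R]_n) i (r : R) :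
  sqnorm (r *: vec_e i + z) = sqnorm z + 2 * r * z 0 i + r ^+ 2.
Proof.
rewrite /sqnorm (bigD1 i)//= [X in _ = X + _ + _](bigD1 i)//=.
rewrite (eq_bigr (fun j => z 0 j ^+ 2)); last first.
  by move=> j ji; rewrite /vec_e !mxE/= (negbTE ji) mulr0 add0r.
by rewrite /vec_e !mxE !eqxx/=; ring.
Qed.

Lemma is_derive_heat_time n (z : 'rV[R]_n) (s : R) : 0 < s ->
  is_derive s 1 (fun s => heat s z)
    (heat s z * (sqnorm z / (4 * s ^+ 2) - n%:R / (2 * s))).
Proof.
move=> s0; rewrite /heat /heat_peak.
have p4 : 0 < 4 * pi :> R by rewrite mulr_gt0 ?pi_gt0.
have h1 : is_derive s 1 (fun s : R => ln (4 * pi * s)) (s^-1).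
  have h0 : is_derive s 1 (fun s : R => 4 * pi * s) (4 * pi).
    by apply: is_derive_eq; rewrite /GRing.scale/= mulr1.
  have q0 : 0 < 4 * pi * s by rewrite mulr_gt0.
  have h := is_derive1_comp (g := fun s => 4 * pi * s) (is_derive1_ln q0) h0.
  apply: (is_derive_eq h).
  (* As a variable, since field would unfold the definition of pi. *)
  have := pi_gt0 R; move: (pi) => p p0.
  by field; rewrite (gt_eqF s0) (gt_eqF p0).
have h2 : is_derive s 1 (fun s : R => (4 * s)^-1) (- (4 * s ^+ 2)^-1).
  have h0 : is_derive s 1 (fun s : R => 4 * s) 4.
    by apply: is_derive_eq; rewrite /GRing.scale/= mulr1.
  have q0 : 4 * s != 0 by rewrite gt_eqF// mulr_gt0.
  apply: (is_derive_eq (is_deriveV (f := fun s : R => 4 * s) q0 h0)).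
  by rewrite /GRing.scale/=; field; rewrite gt_eqF.
have gen (A B : R -> R) (A' B' c d : R) :
    is_derive s 1 A A' -> is_derive s 1 B B' ->
    is_derive s 1 (fun s => expR (- (c * A s)) * expR (- (d * B s)))
      (expR (- (c * A s)) * expR (- (d * B s)) * (- (c * A') - d * B')).
  move=> hA hB; apply: is_derive_eq.
  by rewrite /GRing.scale/=; move: (expR _) (expR _) => a b; ring.
apply: (is_derive_eq (gen _ _ _ _ _ _ h1 h2)).
by congr (_ * _); field; rewrite gt_eqF.
Qed.

Lemma is_derive_heat_space n (z : 'rV[R]_n) i (s r : R) : 0 < s ->
  is_derive r 1 (fun r => heat s (r *: vec_e i + z))
    (heat s (r *: vec_e i + z) * - ((z 0 i + r) / (2 * s))).
Proof.
move=> s0; rewrite /heat.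
under eq_fun do rewrite sqnorm_line.
rewrite sqnorm_line.
apply: is_derive_eq.
rewrite /GRing.scale/=; move: (expR _) (heat_peak _ _) => A B.
by field; rewrite gt_eqF.
Qed.

Lemma is_derive_heat_space2 n (z : 'rV[R]_n) i (s r : R) : 0 < s ->
  is_derive r 1 (fun r => heat s (r *: vec_e i + z) * - ((z 0 i + r) / (2 * s)))
    (heat s (r *: vec_e i + z) * ((z 0 i + r) ^+ 2 / (4 * s ^+ 2) - (2 * s)^-1)).
Proof.
move=> s0; have h := is_derive_heat_space z i r s0.
apply: is_derive_eq.
rewrite /GRing.scale/=; move: (heat _ _) => A.
by field; rewrite gt_eqF.
Qed.

End heat_kernel_derivatives.

(** * Integrals depending on a parameter *)

Section integral_against.
Context {R : realType} {d : measure_display} {Y : measurableType d}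
  (mu : {measure set Y -> \bar R}).
Variable g : Y -> R.
Hypothesis ig : mu.-integrable setT (EFin \o g).

Lemma integrable_mul_bounded (k : Y -> R) (C : R) :
  measurable_fun setT k -> (forall y, `|k y| <= C) ->
  mu.-integrable setT (EFin \o (fun y => k y * g y)).
Proof.
move=> mk kC.
have mg : measurable_fun setT g by apply/measurable_EFinP/measurable_int/ig.
apply: (@le_integrable _ _ _ mu _ measurableT _ (fun y => (C%:E * `|g y|%:E)%E)).
- by apply/measurable_EFinP; exact: measurable_funM.
- move=> y _ /=; rewrite lee_fin normrM (le_trans (ler_wpM2r _ (kC y)))//.
  exact: ler_norm.
- apply: integrableZl => //.
  exact: (integrable_abse ig).
Qed.

(** As g is integrable, bounds on k and its derivative that are uniform in y give
the domination C |g| needed to differentiate under the integral. *)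
Lemma is_derive_Rintegral_mul (k k' : R -> Y -> R) (a e B C : R) :
  0 < e ->
  (forall r, r \in `]a - e, a + e[ -> measurable_fun setT (k r)) ->
  (forall r y, r \in `]a - e, a + e[ -> `|k r y| <= B) ->
  (forall r y, r \in `]a - e, a + e[ -> is_derive r 1 (k ^~ y) (k' r y)) ->
  (forall r y, r \in `]a - e, a + e[ -> `|k' r y| <= C) ->
  is_derive a 1 (fun r => \int[mu]_y (k r y * g y))%R
                (\int[mu]_y (k' a y * g y))%R.
Proof.
move=> e0 mk kB dk k'C.
have aI : a \in `]a - e, a + e[ by rewrite in_itv/= ltrBlDr !ltrDl e0.
have dkg (r : R) (y : Y) : r \in `]a - e, a + e[ ->
    is_derive r 1 (fun r => k r y * g y) (k' r y * g y).
  move=> rI; have h := dk r y rI.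
  by apply: is_derive_eq; rewrite /GRing.scale/= mulr0 add0r mulrC.
pose f := fun r y => k r y * g y.
have fE (r : R) (y : Y) : r \in `]a - e, a + e[ -> partial1of2 f r y = k' r y * g y.
  by move=> rI; rewrite partial1of2E; have h := dkg r y rI; rewrite derive_val.
have H := @cvg_differentiation_under_integral R d Y mu f setT measurableT a (a-e) (a+e) aI.
pose G y := `|C| * `|g y|.
have G0 y : 0 <= G y by rewrite mulr_ge0.
have iG : mu.-integrable setT (EFin \o G).
  by apply: (@integrableZl _ _ _ mu _ measurableT `|C| _ (integrable_abse ig)).
have intf (r : R) : r \in `]a - e, a + e[ -> mu.-integrable setT (EFin \o f r).
  by move=> rI; apply: (integrable_mul_bounded (mk _ rI)) => y; exact: kB.
have df (r : R) (y : Y) : r \in `]a - e, a + e[ -> setT y -> derivable (f ^~ y) r 1.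
  by move=> rI _; have [] := dkg r y rI.
have GU (r : R) (y : Y) : r \in `]a - e, a + e[ -> setT y -> `|partial1of2 f r y| <= G y.
  move=> rI _; rewrite fE// normrM ler_wpM2r//.
  by rewrite (le_trans (k'C _ _ rI))// ler_norm.
have {}H := H intf df G G0 iG GU.
have -> : \int[mu]_y (k' a y * g y) = \int[mu]_y partial1of2 f a y.
  by apply: eq_Rintegral => y _; rewrite fE.
split; last first.
  by rewrite -derive1E /derive1; exact: cvg_lim.
apply/cvg_ex; exists (\int[mu]_y partial1of2 f a y).
by under eq_fun do rewrite scaler1.
Qed.

(** The parameter will be a point of space-time. A failure of continuity at p
would be seen along some sequence converging to p, along which the dominated
convergence theorem applies. *)
Lemma continuous_Rintegral_mul (P : pseudoMetricType R) (k : P -> Y -> R)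
    (p : P) (C : R) :
  (\forall q \near p, measurable_fun setT (k q)) ->
  (\forall q \near p, forall y, `|k q y| <= C) ->
  (forall y, {for p, continuous (k ^~ y)}) ->
  {for p, continuous (fun q => \int[mu]_y (k q y * g y))%R}.
Proof.
move=> mk kC ck; apply/cvgrPdist_lt => e e0; apply: contrapT => nE.
have far (m : nat) : exists q, [/\ ball p m.+1%:R^-1 q, measurable_fun setT (k q),
    (forall y, `|k q y| <= C) &
    ~ `|\int[mu]_y (k p y * g y) - \int[mu]_y (k q y * g y)| < e].
  apply: contrapT => nq; apply: nE.
  near=> q; apply: contrapT => neq; apply: nq; exists q; split => //.
  - by near: q; apply: near_ball; rewrite invr_gt0.
  - by near: q.
  - by near: q.
have {far}/choice[q /all_and4[qp mq qC qfar]] := far.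
have q_p : q m @[m --> \oo] --> p.
  apply/cvg_ballP => r r0; near=> m; apply: le_ball (qp m).
  rewrite invf_ple ?posrE//; near: m.
  have := nbhs_infty_gtr (r^-1); apply: filterS => m /ltW rm.
  by rewrite (le_trans rm)// ler_nat.
have mp : measurable_fun setT (k p) by exact: nbhs_singleton mk.
have pC : forall y, `|k p y| <= C by exact: (nbhs_singleton kC).
have mg : measurable_fun setT g by apply/measurable_EFinP/measurable_int/ig.
have : (\int[mu]_y (k (q m) y * g y))%R @[m --> \oo] --> (\int[mu]_y (k p y * g y))%R.
  apply: fine_cvg; rewrite fineK; last first.
    exact/integrable_fin_num/(integrable_mul_bounded mp pC).
  apply: (@dominated_cvg _ _ _ mu _ _
     (fun m y => (k (q m) y * g y)%:E) _ (fun y => `|C|%:E * `|g y|%:E)%E) => //=.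
  - by move=> m; apply/measurable_EFinP/measurable_funM.
  - move=> y _; apply/cvg_EFin; first exact: nearW.
    apply: cvgMl; exact: (cvg_comp _ _ q_p (ck y)).
  - by apply: (@integrableZl _ _ _ mu _ measurableT `|C| _ (integrable_abse ig)).
  - move=> m y _; rewrite lee_fin normrM ler_wpM2r//.
    by rewrite (le_trans (qC m y))// ler_norm.
move=> /cvgrPdist_lt/(_ _ e0)[m _ /(_ m (leqnn m))].
exact: qfar.
Unshelve. all: by end_near. Qed.

End integral_against.

Section line_derivative.
Context {R : realType} {V : normedModType R}.

(** With its partner for the converse, this reduces directional derivatives on
R^n to derivatives in one real variable. *)
Lemma is_derive_line (f : V -> R) (x v : V) (d : R) :
  is_derive (0:R) 1 (fun r : R => f (r *: v + x)) d -> is_derive x v f d.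
Proof.
move=> [D E]; split; first exact/derivable1P.
rewrite -E /derive; set F := (X in lim (X @ _)); set G := (X in _ = lim (X @ _)).
suff -> : F = G by [].
apply/funext => h; rewrite /F /G /=.
by rewrite scale0r add0r addr0 /GRing.scale/= mulr1.
Qed.

Lemma is_derive_line_at (f : V -> R) (x v : V) (d r : R) :
  is_derive (r *: v + x) v f d -> is_derive r 1 (fun r : R => f (r *: v + x)) d.
Proof.
move=> [D E].
have e : (fun h : R => h^-1 *: (((fun r : R => f (r *: v + x)) \o shift r) (h *: 1) - f (r *: v + x)))
   = (fun h : R => h^-1 *: ((f \o shift (r *: v + x)) (h *: v) - f (r *: v + x))).
  apply/funext => h /=; have -> : h *: (1 : R) = h by rewrite /GRing.scale/= mulr1.
  by rewrite scalerDl addrA.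
split.
  by rewrite /derivable e.
by rewrite /derive e.
Qed.

End line_derivative.

(** * Convolution with the heat kernel *)

Section heat_semigroup.
Context {R : realType} {n : nat}.
Local Notation mu := (@lebesgue_rV R n).

Definition heat_conv (g : 'rV[R]_n -> R) (s : R) (x : 'rV[R]_n) : R :=
  \int[mu]_y (heat s (x - y) * g y).

Variable g : 'rV[R]_n -> R.
Hypothesis ig : mu.-integrable setT (EFin \o g).

Lemma measurable_heatB s (x : 'rV[R]_n) :
  measurable_fun setT (fun y : 'rV[R]_n => heat s (x - y)).
Proof. exact: measurable_heat. Qed.

Lemma measurable_coordB (x : 'rV[R]_n) i :
  measurable_fun setT (fun y : 'rV[R]_n => (x - y) 0 i).
Proof.
rewrite (_ : (fun _ => _) = (fun y => x 0 i - rV_coord i y)); last first.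
  by apply/funext => y; rewrite /rV_coord !mxE.
by apply: measurable_funB => //; exact: measurable_rV_coord.
Qed.

Lemma normr_heat_le s (z : 'rV[R]_n) : 0 < s -> `|heat s z| <= heat_peak n s.
Proof. by move=> s0; rewrite ger0_norm ?heat_ge0// heat_le_peak. Qed.

Lemma heat_quadratic_le s (z : 'rV[R]_n) (w : R) : 0 < s -> 0 <= w -> w <= 1 + sqnorm z ->
  heat s z * w <= (1 + 4 * s) * heat_peak n s.
Proof.
move=> s0 w0 wz; apply: le_trans (_ : heat s z * (1 + sqnorm z) <= _).
  by apply: ler_wpM2l => //; exact: heat_ge0.
rewrite mulrDr mulr1 mulrDl mul1r [_ * sqnorm z]mulrC.
by apply: lerD; [exact: heat_le_peak|exact: sqnorm_heat_le].
Qed.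

Lemma normr_coord_le (z : 'rV[R]_n) i : `|z 0 i| <= 1 + sqnorm z.
Proof.
have := sqr_coord_le z i; have := sqr_ge0 (`|z 0 i| - 1).
rewrite -(real_normK (num_real (z 0 i))); nra.
Qed.

Lemma normr_heat_hessian_le s (z : 'rV[R]_n) i : 0 < s ->
  `|heat s z * (z 0 i ^+ 2 / (4 * s ^+ 2) - (2 * s)^-1)| <=
  (1 + 4 * s) * heat_peak n s / (4 * s ^+ 2) + heat_peak n s / (2 * s).
Proof.
move=> s0; rewrite normrM (ger0_norm (heat_ge0 _ _)).
have s20 : 0 <= (2 * s)^-1 by rewrite invr_ge0 mulr_ge0// ltW.
have s40 : 0 <= (4 * s ^+ 2)^-1 by rewrite invr_ge0 mulr_ge0// sqr_ge0.
apply: (@le_trans _ _ (heat s z * (z 0 i ^+ 2 / (4 * s ^+ 2) + (2 * s)^-1))).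
  apply: ler_wpM2l; first exact: heat_ge0.
  apply: le_trans (ler_normB _ _) _.
  by rewrite !ger0_norm// mulr_ge0// sqr_ge0.
rewrite mulrDr mulrA; apply: lerD.
  rewrite ler_wpM2r//; apply: heat_quadratic_le => //; first exact: sqr_ge0.
  by apply: (le_trans (sqr_coord_le z i)); rewrite lerDr.
by rewrite ler_wpM2r// heat_le_peak.
Qed.

Lemma is_derive_heat_conv_space i s (x : 'rV[R]_n) : 0 < s ->
  is_derive x (vec_e i) (heat_conv g s)
    (\int[mu]_y ((heat s (x - y) * - ((x - y) 0 i / (2 * s))) * g y)).
Proof.
move=> s0; apply: is_derive_line; rewrite /heat_conv.
pose k' (r : R) (y : 'rV[R]_n) :=
  heat s (r *: vec_e i + x - y) * - (((x - y) 0 i + r) / (2 * s)).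
rewrite [X in is_derive _ _ _ X](_ : _ = \int[mu]_y (k' 0 y * g y)); last first.
  by apply: eq_Rintegral => y _; rewrite /k' scale0r add0r addr0.
apply: (is_derive_Rintegral_mul ig (B := heat_peak n s)
  (C := (1 + 4 * s) * heat_peak n s / (2 * s)) ltr01).
- by move=> r _; exact: measurable_heat.
- by move=> r y _; exact: normr_heat_le.
- move=> r y _; rewrite /k'; under eq_fun do rewrite -addrA.
  rewrite -addrA; exact: is_derive_heat_space.
- move=> r y _; rewrite /k' normrM normrN (ger0_norm (heat_ge0 _ _)).
  rewrite normrM [X in _ * (_ * X)]ger0_norm ?invr_ge0 ?mulr_ge0 ?(ltW s0)//.
  rewrite mulrA ler_wpM2r ?invr_ge0 ?mulr_ge0 ?(ltW s0)//.
  apply: heat_quadratic_le => //.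
  rewrite (_ : (x - y) 0 i + r = (r *: vec_e i + x - y) 0 i).
    exact: normr_coord_le.
  by rewrite /vec_e !mxE/= !eqxx mulr1; ring.
Qed.

Lemma is_derive_heat_conv_space2 i s (x : 'rV[R]_n) : 0 < s ->
  is_derive x (vec_e i) ('D_(vec_e i) (heat_conv g s))
    (\int[mu]_y ((heat s (x - y) *
       (((x - y) 0 i) ^+ 2 / (4 * s ^+ 2) - (2 * s)^-1)) * g y)).
Proof.
move=> s0.
rewrite (_ : 'D_(vec_e i) (heat_conv g s) = fun x =>
  \int[mu]_y ((heat s (x - y) * - ((x - y) 0 i / (2 * s))) * g y)); last first.
  by apply/funext => z; have h := is_derive_heat_conv_space i z s0; rewrite derive_val.
apply: is_derive_line.
pose k' (r : R) (y : 'rV[R]_n) := heat s (r *: vec_e i + x - y) *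
  (((x - y) 0 i + r) ^+ 2 / (4 * s ^+ 2) - (2 * s)^-1).
rewrite [X in is_derive _ _ _ X](_ : _ = \int[mu]_y (k' 0 y * g y)); last first.
  by apply: eq_Rintegral => y _; rewrite /k' scale0r add0r addr0.
have cE r y : (r *: vec_e i + x - y) 0 i = (x - y) 0 i + r.
  by rewrite /vec_e !mxE/= !eqxx mulr1; ring.
have s20 : 0 <= (2 * s)^-1 by rewrite invr_ge0 mulr_ge0// ltW.
apply: (is_derive_Rintegral_mul ig
  (B := (1 + 4 * s) * heat_peak n s / (2 * s))
  (C := (1 + 4 * s) * heat_peak n s / (4 * s ^+ 2) + heat_peak n s / (2 * s)) ltr01).
- move=> r _; apply: measurable_funM; first exact: measurable_heat.
  apply: measurableT_comp => //; apply: measurable_funM => //.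
  exact: measurable_coordB.
- move=> r y _; rewrite normrM normrN (ger0_norm (heat_ge0 _ _)).
  rewrite normrM [X in _ * (_ * X)]ger0_norm//.
  by rewrite mulrA ler_wpM2r//; apply: heat_quadratic_le => //; exact: normr_coord_le.
- move=> r y _; rewrite /k'.
  under eq_fun do rewrite cE -addrA.
  rewrite -addrA; exact: is_derive_heat_space2.
- by move=> r y _; rewrite /k' -cE; exact: normr_heat_hessian_le.
Qed.

Lemma is_derive_heat_conv_time (s : R) (x : 'rV[R]_n) : 0 < s ->
  is_derive s 1 (heat_conv g ^~ x)
    (\int[mu]_y ((heat s (x - y) *
       (sqnorm (x - y) / (4 * s ^+ 2) - n%:R / (2 * s))) * g y)).
Proof.
move=> s0; rewrite /heat_conv.
have s20 : 0 < s / 2 by rewrite divr_gt0.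
have rI (r : R) : r \in `]s - s / 2, s + s / 2[ -> s / 2 < r /\ r < 2 * s.
  rewrite in_itv/=; lra.
apply: (@is_derive_Rintegral_mul R _ _ mu g ig
  (fun r y => heat r (x - y))
  (fun r y => heat r (x - y) * (sqnorm (x - y) / (4 * r ^+ 2) - n%:R / (2 * r)))
  s (s / 2) (heat_peak n (s / 2))
  (heat_peak n (s / 2) * (2 / s) + heat_peak n (s / 2) * (n%:R * s^-1)) s20).
- by move=> r _; exact: measurable_heat.
- move=> r y /rI[sr _]; have r0 := lt_trans s20 sr.
  apply: le_trans (normr_heat_le _ r0) _; exact/heat_peak_le/ltW.
- move=> r y /rI[sr _]; have r0 := lt_trans s20 sr.
  exact: is_derive_heat_time.
- move=> r y /rI[sr _]; have r0 := lt_trans s20 sr.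
  have pr : heat_peak n r <= heat_peak n (s / 2) by exact/heat_peak_le/ltW.
  have ri : r^-1 <= 2 / s.
    by rewrite -[2 / s]invrK invf_div lef_pV2 ?posrE// ltW.
  have p0 : 0 <= r^-1 by rewrite invr_ge0 ltW.
  rewrite normrM (ger0_norm (heat_ge0 _ _)).
  set z := x - y.
  apply: (@le_trans _ _ (heat r z * (sqnorm z / (4 * r ^+ 2) + n%:R / (2 * r)))).
    apply: ler_wpM2l; first exact: heat_ge0.
    apply: le_trans (ler_normB _ _) _.
    by rewrite !ger0_norm// divr_ge0 ?mulr_ge0 ?sqr_ge0 ?sqnorm_ge0// ltW.
  rewrite mulrDr; apply: lerD.
    rewrite mulrA [_ * sqnorm z]mulrC.
    apply: (@le_trans _ _ (4 * r * heat_peak n r / (4 * r ^+ 2))).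
      apply: ler_wpM2r; last exact: sqnorm_heat_le.
      by rewrite invr_ge0 mulr_ge0// sqr_ge0.
    have -> : 4 * r * heat_peak n r / (4 * r ^+ 2) = heat_peak n r * r^-1.
      by move: (heat_peak _ _) => h; field; rewrite gt_eqF.
    by apply: ler_pM => //; exact/ltW/heat_peak_gt0.
  apply: ler_pM => //; first exact: heat_ge0.
  - by rewrite divr_ge0// mulr_ge0// ltW.
  - by rewrite (le_trans (heat_le_peak _ r0)).
  - rewrite ler_wpM2l// invfM.
    have -> : s^-1 = 2^-1 * (2 / s) by field; rewrite gt_eqF.
    by rewrite ler_wpM2l// invr_ge0.
Qed.

End heat_semigroup.

Lemma Rintegral_sum (R : realType) d (Y : measurableType d)
    (mu : {measure set Y -> \bar R}) (I : Type) (s : seq I) (h : I -> Y -> R) :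
  (forall i, mu.-integrable setT (EFin \o h i)) ->
  \sum_(i <- s) \int[mu]_y h i y = \int[mu]_y (\sum_(i <- s) h i y).
Proof.
move=> ih; suff [] : mu.-integrable setT (EFin \o (fun y => \sum_(i <- s) h i y)) /\
  \sum_(i <- s) \int[mu]_y h i y = \int[mu]_y (\sum_(i <- s) h i y) by [].
elim: s => [|i s [IH1 IH2]].
  under [in X in X /\ _]eq_fun do rewrite big_nil.
  rewrite big_nil; under eq_Rintegral do rewrite big_nil.
  split; last by rewrite /Rintegral integral0.
  rewrite (_ : EFin \o _ = cst 0%E)//; exact: integrable0.
split; last first.
  rewrite big_cons; under [RHS]eq_Rintegral do rewrite big_cons.
  by rewrite RintegralD// IH2.
rewrite (_ : _ \o _ = (EFin \o h i) \+ (EFin \o (fun y => \sum_(i <- s) h i y)%R))%E.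
  exact: integrableD.
by apply/funext => y /=; rewrite big_cons.
Qed.

Section heat_semigroup_properties.
Context {R : realType} {n : nat}.
Local Notation mu := (@lebesgue_rV R n).
Variable g : 'rV[R]_n -> R.
Hypothesis ig : mu.-integrable setT (EFin \o g).

Let mg : measurable_fun setT g.
Proof. by apply/measurable_EFinP/measurable_int/ig. Qed.

Lemma derivable_heat_conv i (s : R) (x : 'rV[R]_n) : 0 < s ->
  derivable (heat_conv g s) x (vec_e i).
Proof. by move=> s0; have [] := is_derive_heat_conv_space ig i x s0. Qed.

Lemma derivable2_heat_conv i (s : R) (x : 'rV[R]_n) : 0 < s ->
  derivable ('D_(vec_e i) (heat_conv g s)) x (vec_e i).
Proof. by move=> s0; have [] := is_derive_heat_conv_space2 ig i x s0. Qed.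

(** The second derivatives of the kernel are the kernel times
z_i^2 / (4 s^2) - 1 / (2 s); summed over i these factors give
|z|^2 / (4 s^2) - n / (2 s), the factor of the derivative in s. *)
Lemma heat_equation (s : R) (x : 'rV[R]_n) : 0 < s ->
  is_derive s 1 (heat_conv g ^~ x) (laplacian (heat_conv g s) x).
Proof.
move=> s0; have h := is_derive_heat_conv_time ig x s0.
apply: (is_derive_eq h); rewrite /laplacian.
rewrite [RHS](eq_bigr (fun i => \int[mu]_y ((heat s (x - y) *
       (((x - y) 0 i) ^+ 2 / (4 * s ^+ 2) - (2 * s)^-1)) * g y))); last first.
  by move=> i _; have hi := is_derive_heat_conv_space2 ig i x s0; rewrite derive_val.
rewrite Rintegral_sum.
  apply: eq_Rintegral => y _; rewrite -mulr_suml -mulr_sumr.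
  congr (_ * _ * _); rewrite sumrB -mulr_suml; congr (_ - _).
  by rewrite sumr_const card_ord mulr_natl.
move=> i; apply: (integrable_mul_bounded ig
  (C := (1 + 4 * s) * heat_peak n s / (4 * s ^+ 2) + heat_peak n s / (2 * s))).
  apply: measurable_funM; first exact: measurable_heatB.
  apply: measurable_funB => //; apply: measurable_funM => //.
  by apply: measurable_funX; exact: measurable_coordB.
by move=> y; exact: normr_heat_hessian_le.
Qed.

Lemma continuous_sqnormB (y : 'rV[R]_n) : continuous (fun x : 'rV[R]_n => sqnorm (x - y)).
Proof.
have -> : (fun x : 'rV[R]_n => sqnorm (x - y)) =
    (fun x => \sum_(i < n) (x 0 i - y 0 i) ^+ 2).
  by apply/funext => x; apply: eq_bigr => i _; rewrite !mxE.
apply: continuous_big => [|i _ x]; first exact: add_continuous.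
have h : {for x, continuous (fun z : 'rV[R]_n => z 0 i - y 0 i)}.
  apply: (@continuousB R R^o 'rV[R]_n (fun z => z 0 i) (fun=> y 0 i) x).
    exact: coord_continuous.
  exact: cst_continuous.
exact: (cvg_comp _ _ h (@exprn_continuous R 2 _)).
Qed.

Lemma continuous_heat (y : 'rV[R]_n) (s : R) (x : 'rV[R]_n) : 0 < s ->
  {for (s, x), continuous (fun q : R * 'rV[R]_n => heat q.1 (q.2 - y))}.
Proof.
move=> s0; rewrite /heat /heat_peak.
have p4 : 0 < 4 * pi * s by rewrite mulr_gt0// mulr_gt0// pi_gt0.
set P := (R * 'rV[R]_n)%type.
have c1 : {for (s, x) : P, continuous (fun q : P => q.1)} by exact: cvg_fst.
have c2 : {for (s, x) : P, continuous (fun q : P => sqnorm (q.2 - y))}.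
  apply: (@continuous_comp P 'rV[R]_n R snd (fun x => sqnorm (x - y))).
    exact: cvg_snd.
  exact: continuous_sqnormB.
have cm (c : R) : {for (s, x) : P, continuous (fun q : P => c * q.1)}.
  by apply: continuousM => //; exact: cst_continuous.
have c3 : {for (s, x) : P, continuous (fun q : P => ln (4 * pi * q.1))}.
  apply: (@continuous_comp P R R (fun q => 4 * pi * q.1) (@ln R)).
    exact: cm.
  exact: continuous_ln.
have c4 : {for (s, x) : P, continuous (fun q : P => (4 * q.1)^-1)}.
  by apply: continuousV; [rewrite gt_eqF// mulr_gt0|exact: cm].
apply: continuousM.
  apply: (@continuous_comp P R R (fun q => - (n%:R / 2 * ln (4 * pi * q.1))) expR).
    apply: continuousN; apply: continuousM => //; exact: cst_continuous.
  exact: continuous_expR.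
apply: (@continuous_comp P R R (fun q => - (sqnorm (q.2 - y) / (4 * q.1))) expR).
  by apply: continuousN; apply: continuousM.
exact: continuous_expR.
Qed.

Lemma continuous_heat_conv (s : R) (x : 'rV[R]_n) : 0 < s ->
  {for (s, x), continuous (fun q : R * 'rV[R]_n => heat_conv g q.1 q.2)}.
Proof.
move=> s0; rewrite /heat_conv.
have s2 : 0 < s / 2 by rewrite divr_gt0.
have h1 : \forall q \near ((s, x) : R * 'rV[R]_n),
    measurable_fun setT (fun y : 'rV[R]_n => heat q.1 (q.2 - y)).
  by near=> q; exact: measurable_heatB.
have h2 : \forall q \near ((s, x) : R * 'rV[R]_n),
    forall y, `|heat q.1 (q.2 - y)| <= heat_peak n (s / 2).
  have : \forall q \near ((s, x) : R * 'rV[R]_n), s / 2 < q.1.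
    have c1 : {for ((s, x) : R * 'rV[R]_n), continuous (fun q => q.1)}.
      exact: cvg_fst.
    have s2s : s / 2 < s by rewrite ltr_pdivrMr// mulr_natr mulr2n ltrDl.
    exact: (c1 [set r | s / 2 < r] (lt_nbhsr s2s)).
  apply: filterS => q sq y; apply: le_trans (normr_heat_le _ _) _.
    exact: lt_trans sq.
  exact/heat_peak_le/ltW.
exact: (continuous_Rintegral_mul ig h1 h2 (fun y => @continuous_heat y s x s0)).
Unshelve. all: by end_near. Qed.

Lemma integrable_heat_mul (s : R) (x : 'rV[R]_n) : 0 < s ->
  mu.-integrable setT (EFin \o (fun y => heat s (x - y) * g y)).
Proof.
move=> s0; apply: (integrable_mul_bounded ig (C := heat_peak n s)).
  exact: measurable_heatB.
by move=> y; exact: normr_heat_le.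
Qed.

Hypothesis g0 : forall y, 0 <= g y.

Lemma heat_conv_ge0 s x : 0 <= heat_conv g s x.
Proof.
by apply: Rintegral_ge0 => y _; apply: mulr_ge0 => //; exact: heat_ge0.
Qed.

Lemma heat_conv_le_peak (s : R) x : 0 < s ->
  heat_conv g s x <= heat_peak n s * \int[mu]_y g y.
Proof.
move=> s0; rewrite /heat_conv -RintegralZl//.
apply: le_Rintegral => //; first exact: integrable_heat_mul.
  exact: (@integrableZl _ _ _ mu _ measurableT (heat_peak n s) _ ig).
by move=> y _; apply: ler_wpM2r => //; exact: heat_le_peak.
Qed.

Lemma heat_convE (s : R) x : 0 < s ->
  (heat_conv g s x)%:E = (\int[mu]_y (heat s (x - y) * g y)%:E)%E.
Proof.
by move=> s0; rewrite /heat_conv /Rintegral fineK//;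
   exact/integrable_fin_num/integrable_heat_mul.
Qed.

(** Tonelli's theorem, the symmetry of the kernel and its unit mass. *)
Lemma integral_heat_conv (s : R) : 0 < s ->
  (\int[mu]_x (heat_conv g s x)%:E = \int[mu]_y (g y)%:E)%E.
Proof.
move=> s0; under eq_integral do rewrite heat_convE//.
rewrite (fubini_tonelli (fun z : 'rV[R]_n * 'rV[R]_n => (heat s (z.1 - z.2) * g z.2)%:E))/=.
- apply: eq_integral => y _.
  under eq_integral do rewrite mulrC EFinM heatC.
  rewrite ge0_integralZl//.
  + by rewrite integral_heat// mule1.
  + by apply/measurable_EFinP; exact: measurable_heat.
  + by move=> x _; rewrite lee_fin heat_ge0.
  + by rewrite lee_fin.
- apply/measurable_EFinP; apply: measurable_funM; first exact: measurable_heat.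
  exact: measurableT_comp.
- by move=> z; rewrite lee_fin; apply: mulr_ge0 => //; exact: heat_ge0.
Qed.

Lemma measurable_heat_conv (s : R) : 0 < s -> measurable_fun setT (heat_conv g s).
Proof.
move=> s0; apply/measurable_EFinP.
rewrite (_ : _ \o _ = fubini_F mu
  (fun z : 'rV[R]_n * 'rV[R]_n => (heat s (z.1 - z.2) * g z.2)%:E)); last first.
  by apply/funext => x /=; rewrite heat_convE.
apply: measurable_fun_fubini_tonelli_F.
- apply/measurable_EFinP; apply: measurable_funM; first exact: measurable_heat.
  exact: measurableT_comp.
- by move=> z; rewrite lee_fin; apply: mulr_ge0 => //; exact: heat_ge0.
Qed.

Lemma integrable_heatB (s : R) (x : 'rV[R]_n) : 0 < s ->
  mu.-integrable setT (EFin \o (fun y => heat s (x - y))).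
Proof.
move=> s0; apply/integrableP; split.
  by apply/measurable_EFinP; exact: measurable_heat.
under eq_integral do rewrite /= ger0_norm ?heat_ge0//.
by rewrite integral_heat// ltry.
Qed.

Lemma Rintegral_heat (s : R) (x : 'rV[R]_n) : 0 < s -> \int[mu]_y heat s (x - y) = 1.
Proof. by move=> s0; rewrite /Rintegral integral_heat. Qed.

(** The comparison functions used later start at a small positive time delta, so
they must be seen to lie above g there, up to eta. Near x the continuity of g,
uniform on D, bounds the convolution from below; far from x the kernel is small
by [heat_tail]. *)
Lemma heat_conv_initial (M eta : R) (D : set 'rV[R]_n) :
  (forall y, g y <= M) -> continuous g -> compact D -> 0 < eta ->
  exists2 delta0, 0 < delta0 & forall delta x, 0 < delta < delta0 -> D x ->
    g x <= heat_conv g delta x + eta.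
Proof.
move=> gM cg cD e0; have e20 : 0 < eta / 2 by rewrite divr_gt0.
have [r r0 rP] : exists2 r : R, 0 < r & forall x y : 'rV[R]_n, D x ->
    (forall i, `|x 0 i - y 0 i| < r) -> g x - eta / 2 <= g y.
  move/compact_near_coveringP : cD => /(_ R 0^'+
    (fun r x => forall y, ball x r y -> g x - eta / 2 <= g y) _).
  case=> [x Dx|e /= e1 eP].
    have e40 : 0 < eta / 4 by rewrite divr_gt0.
    have /cvgrPdist_lt/(_ _ e40) /nbhs_ballP[e /= e1 eP] := cg x.
    exists (ball x (e / 2), [set r | 0 < r < e / 2]) => /=.
      split; first by apply: nbhsx_ballx; rewrite divr_gt0.
      near=> r; apply/andP; split => //.
      by near: r; apply: nbhs_right_lt; rewrite divr_gt0.
    move=> [x' r] /= [xx' /andP[r0 re]] y x'y.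
    have h1 := eP x' (le_ball _ xx').
    have h2 := eP y (ball_split xx' (le_ball (ltW re) x'y)).
    have {}h1 : `|g x - g x'| < eta / 4 by apply: h1; rewrite ler_pdivrMr// ler_peMr ?ler1n// ltW.
    move: h1 h2; rewrite !ltr_norml; lra.
  exists (e / 2); first by rewrite divr_gt0.
  move=> x y Dx xy; apply: (eP (e / 2)) => //=.
  - by rewrite sub0r normrN gtr0_norm ?divr_gt0// ltr_pdivrMr// mulr_natr mulr2n ltrDl.
  - by rewrite divr_gt0.
  - split; first by rewrite divr_gt0.
    by move=> i j; rewrite ord1; exact: xy.
pose E := expR (n%:R / 2 * ln 2) : R.
have E0 : 0 < E by exact: expR_gt0.
have M0 : 0 <= M by apply: le_trans (g0 0) _.
exists (eta * r ^+ 2 / (16 * (M * E + 1))).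
  by rewrite divr_gt0// mulr_gt0 ?exprn_gt0// ltr_wpDl// mulr_ge0// ltW.
move=> d x /andP[d0 dd] Dx.
have d20 : 0 < 2 * d by rewrite mulr_gt0.
pose c := E * expR (- (r ^+ 2 / (8 * d))).
have c0 : 0 <= c by rewrite mulr_ge0 ?expR_ge0// ltW.
(* A single inequality for all y, near and far: where y is near x the subtracted
   term only helps, and where it is far that term exceeds the first one. *)
have pw y : heat d (x - y) * (g x - eta / 2) - (M * c) * heat (2 * d) (x - y)
    <= heat d (x - y) * g y.
  have [xy|] := pselect (forall i, `|x 0 i - y 0 i| < r).
    have := rP x y Dx xy; have h0 := heat_ge0 d (x - y) => h1.
    have := ler_wpM2l h0 h1; apply: le_trans.
    by rewrite gerBl mulr_ge0 ?heat_ge0// mulr_ge0.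
  move=> /existsNP[i /negP]; rewrite -leNgt => xyr.
  have rs : r ^+ 2 <= sqnorm (x - y).
    apply: le_trans (sqr_coord_le (x - y) i); rewrite !mxE.
    by rewrite -[X in _ <= X](real_normK (num_real _)) ler_sqr ?nnegrE// ltW.
  have ht := heat_tail d0 rs; rewrite -/E -/c in ht.
  apply: (@le_trans _ _ 0); last by rewrite mulr_ge0// heat_ge0.
  rewrite subr_le0 -mulrA; apply: (@le_trans _ _ (M * heat d (x - y))).
    rewrite [M * _]mulrC ler_wpM2l ?heat_ge0//.
    by rewrite lerBlDr (le_trans (gM x))// lerDl ltW.
  by rewrite ler_wpM2l.
have : g x - eta / 2 - M * c <= heat_conv g d x.
  rewrite /heat_conv.
  have i1 := integrable_heatB x d0; have i2 := integrable_heatB x d20.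
  have j1 : mu.-integrable setT (EFin \o (fun y => heat d (x - y) * (g x - eta / 2))).
    by apply: (@integrableZr _ _ _ mu _ measurableT (g x - eta / 2) _ i1).
  have j2 : mu.-integrable setT (EFin \o (fun y => M * c * heat (2 * d) (x - y))).
    by apply: (@integrableZl _ _ _ mu _ measurableT (M * c) _ i2).
  have -> : g x - eta / 2 - M * c = \int[mu]_y
    (heat d (x - y) * (g x - eta / 2) - (M * c) * heat (2 * d) (x - y)).
    rewrite RintegralB// RintegralZr// RintegralZl// !Rintegral_heat//.
    by rewrite mul1r mulr1.
  apply: le_Rintegral => //.
    by apply: (@integrableB _ _ _ mu _ measurableT _ _ j1 j2).
  exact: integrable_heat_mul.
suff : M * c <= eta / 2 by lra.
have cle : c <= E * (8 * d / r ^+ 2).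
  rewrite ler_pM2l//.
  have u0 : 0 < r ^+ 2 / (8 * d) by rewrite divr_gt0 ?exprn_gt0// mulr_gt0.
  have := mulr_expRN_le1 (r ^+ 2 / (8 * d)).
  by rewrite -ler_pdivlMl// mulr1 invf_div.
apply: (le_trans (ler_wpM2l M0 cle)).
have r20 : 0 < r ^+ 2 by rewrite exprn_gt0.
have ME : 0 < M * E + 1 by rewrite ltr_wpDl// mulr_ge0// ltW.
move: dd; rewrite ltr_pdivlMr => [dd0|]; last by rewrite mulr_gt0.
move: dd0; rewrite (mulrA M) (mulrA (M * E)) ler_pdivrMr//.
move: (M * E) (r ^+ 2) => a b dd; lra.
Unshelve. all: by end_near. Qed.

End heat_semigroup_properties.

(** * The maximum principle *)

Section one_sided_calculus.
Context {R : realType}.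

(** In a parabolic maximum principle the maximum may occur at the final time,
where only the past can be compared with it. *)
Lemma derive_left_max_ge0 (f : R -> R) (a b d : R) : a < b ->
  is_derive b 1 f d -> (forall t, a <= t <= b -> f t <= f b) -> 0 <= d.
Proof.
move=> ab [D E] fb; rewrite leNgt; apply/negP => d0.
have : h^-1 *: (f (h *: 1 + b) - f b) @[h --> 0^'] --> d.
  by rewrite -E; exact: D.
move=> /(cvgr_lt d) /(_ 0 d0) /nbhs_ballP[e /= e0 eP].
pose h := - Num.min (e / 2) (b - a).
have h0 : h < 0 by rewrite oppr_lt0 lt_min divr_gt0//= subr_gt0.
have := eP h; rewrite /ball/= sub0r normrN ltr0_norm// opprK => /(_ _ _).
rewrite gt_min ltr_pdivrMr// mulr_natr mulr2n ltrDl e0 => /(_ isT).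
rewrite lt_eqF// => /(_ isT).
rewrite /GRing.scale/= mulr1 nmulr_rlt0 ?invr_lt0// subr_gt0 ltNge => /negP; apply.
apply: fb; rewrite gerDr (ltW h0) andbT -lerBlDr lerNr opprB.
by rewrite ge_min lexx orbT.
Qed.

(** Otherwise 'D_v f, which vanishes at the maximum x, would be positive on the
line through x just after x, and f would increase there. *)
Lemma derive2_max_le0 (V : normedModType R) (f : V -> R) (x v : V) :
  (forall x, derivable f x v) -> derivable ('D_v f) x v ->
  (forall y, f y <= f x) -> 'D_v ('D_v f) x <= 0.
Proof.
move=> df d2f fx; rewrite leNgt; apply/negP => d0.
pose p (r : R) := f (r *: v + x).
have dp (r : R) : is_derive r 1 p ('D_v f (r *: v + x)).
  exact: (is_derive_line_at (derivableP (df _))).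
have p00 : 'D_v f x = 0.
  have p'0 : is_derive (0 : R) 1 p 0.
    have h1 : (-1 : R) <= 1 by lra.
    have h2 : (0 : R) \in `]-1, 1[ by rewrite in_itv/=; lra.
    have h3 (t : R) : t \in `]-1, 1[ -> derivable p t 1 by case: (dp t).
    apply: (derive1_at_max h1 h3 h2) => t _.
    by rewrite /p scale0r add0r.
  have [_ E1] := p'0; have [_] := dp 0.
  by rewrite E1 scale0r add0r.
have : h^-1 *: ('D_v f (h *: v + x) - 'D_v f x) @[h --> 0^'] --> 'D_v ('D_v f) x.
  exact: d2f.
move=> /(cvgr_gt _) /(_ 0 d0) /nbhs_ballP[e /= e0 eP].
have e2 : 0 < e / 2 by rewrite divr_gt0.
have [c ce] := @MVT R p (fun r => 'D_v f (r *: v + x)) 0 (e / 2) e2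
  (fun r _ => dp r)
  (derivable_within_continuous (fun r _ => let: DeriveDef D _ := dp r in D)).
move: ce; rewrite in_itv/= => /andP[c0 ce].
have : 0 < 'D_v f (c *: v + x).
  have := eP c; rewrite /ball/= sub0r normrN gtr0_norm// gt_eqF// => /(_ _ isT).
  rewrite p00 subr0 /GRing.scale/= pmulr_rgt0 ?invr_gt0//; apply.
  by rewrite (lt_trans ce)// ltr_pdivrMr// mulr_natr mulr2n ltrDl.
move=> p'c; rewrite subr0 => pE.
have : 0 < p (e / 2) - p 0 by rewrite pE mulr_gt0.
by rewrite subr_gt0 ltNge /p scale0r add0r fx.
Qed.

Lemma is_derive_sqnorm n (x : 'rV[R]_n) i :
  is_derive x (vec_e i) (@sqnorm R n) (2 * x 0 i).
Proof.
apply: is_derive_line; under eq_fun do rewrite sqnorm_line.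
by apply: is_derive_eq; rewrite /GRing.scale/=; ring.
Qed.

Lemma is_derive_coord n (x : 'rV[R]_n) i :
  is_derive x (vec_e i) (fun x : 'rV[R]_n => x 0 i) 1.
Proof.
apply: is_derive_line.
rewrite (_ : (fun _ => _) = (fun r : R => r + x 0 i)).
  by apply: is_derive_eq; rewrite addr0.
by apply/funext => r; rewrite /vec_e !mxE/= !eqxx mulr1.
Qed.

Lemma continuous_sqnorm n : continuous (@sqnorm R n).
Proof.
move=> x; have := @continuous_sqnormB R n 0 x.
by under eq_fun do rewrite subr0.
Qed.

Lemma compact_cube n (rho : R) : compact [set x : 'rV[R]_n | forall i, `|x 0 i| <= rho].
Proof.
have := @rV_compact R n (fun=> [set` `[- rho, rho]%R]) (fun=> @segment_compact _ _ _).
congr compact; apply/seteqP; split=> x /= h i; have := h i;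
  by rewrite in_itv/= ler_norml.
Qed.

End one_sided_calculus.

Section maximum_principle.
Context {R : realType} {n : nat}.
Implicit Types w H : R -> 'rV[R]_n -> R.

(** The function z = exp(Q) H is a supersolution of z_t = Delta z + kap z, but in
a weak sense, since kap may jump and Q need not be differentiable: only the
increments of Q are bounded below. This is enough. At a positive maximum
(t0, x0) of exp(- Lam (t - a)) (w - z) - B one replaces exp(Q(t)), for t <= t0,
by the larger function exp(Q(t0) + kap(t0) (t - t0)); both agree at t0, so t0 is
still a maximum from the left, now of a differentiable function. The
exponential weight absorbs the term in Lam. The barrier
B = eta (1 + |x|^2 + (2 n + 1) (t - a)) confines the maximum to a compact set,
and B_t - Delta B = eta > 0 makes the inequalities at (t0, x0) contradictory. *)
Lemma maximum_principle w H (kap Q : R -> R) (a b Lam M eta : R) :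
  a < b -> 0 <= Lam -> 0 < eta ->
  (forall t x, a <= t <= b -> {for (t, x), continuous (fun z => w z.1 z.2)}) ->
  (forall t x, a <= t <= b -> {for (t, x), continuous (fun z => H z.1 z.2)}) ->
  (forall t, a <= t <= b -> {for t, continuous Q}) ->
  (forall s t, a <= s -> s <= t -> t <= b -> kap t * (t - s) <= Q t - Q s) ->
  Q a = 0 ->
  (forall t x, a < t <= b -> derivable (w ^~ x) t 1) ->
  (forall t x i, a < t <= b -> derivable (w t) x (vec_e i)) ->
  (forall t x i, a < t <= b -> derivable ('D_(vec_e i) (w t)) x (vec_e i)) ->
  (forall t x, a < t <= b -> is_derive t 1 (H ^~ x) (laplacian (H t) x)) ->
  (forall t x i, a < t <= b -> derivable (H t) x (vec_e i)) ->
  (forall t x i, a < t <= b -> derivable ('D_(vec_e i) (H t)) x (vec_e i)) ->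
  (forall t x, a <= t <= b -> w t x <= M) ->
  (forall t x, a <= t <= b -> 0 <= H t x) ->
  (forall x, w a x <= H a x + eta * (1 + sqnorm x)) ->
  (forall t x, a < t <= b -> expR (Q t) * H t x < w t x ->
    derive1 (w ^~ x) t - laplacian (w t) x <=
      kap t * (expR (Q t) * H t x) + Lam * (w t x - expR (Q t) * H t x)) ->
  forall t x, a <= t <= b ->
    w t x <= expR (Q t) * H t x +
      expR (Lam * (t - a)) * (eta * (1 + sqnorm x + (2 * n%:R + 1) * (t - a))).
Proof.
move=> ab Lam0 eta0 cw cH cQ Qkap Qa wt wx wxx Ht Hx Hxx wM H0 winit wsub t1 x1 t1ab.
pose c : R := 2 * n%:R + 1.
have c0 : 0 <= c by rewrite addr_ge0 ?mulr_ge0.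
pose E (t : R) := expR (- (Lam * (t - a))).
have E0 t : 0 < E t by exact: expR_gt0.
pose B (t : R) (x : 'rV[R]_n) := eta * (1 + sqnorm x + c * (t - a)).
pose D (t : R) (x : 'rV[R]_n) := E t * (w t x - expR (Q t) * H t x) - B t x.
suff Dle : D t1 x1 <= 0.
  move: Dle; rewrite /D subr_le0 mulrC -ler_pdivlMr// lerBlDl => /le_trans; apply.
  by rewrite lerD2l /E expRN invrK mulrC.
rewrite leNgt; apply/negP => D1.
(* Beyond |x_i| = rho the barrier exceeds the bound M of w, because
   rho >= 1 gives eta rho^2 >= eta rho >= |M|. *)
pose rho := Num.max 1 (`|M| / eta).
have rho1 : 1 <= rho by rewrite le_max lexx.
have rho0 : 0 <= rho by exact: le_trans rho1.
have rhoM : `|M| <= eta * rho ^+ 2.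
  rewrite mulrC -ler_pdivrMr//; apply: (@le_trans _ _ rho).
    by rewrite le_max lexx orbT.
  by rewrite expr2 ler_peMr// (le_trans ler01).
have Dout t x : a <= t <= b -> 0 < D t x -> forall i, `|x 0 i| <= rho.
  move=> tab Dtx i; rewrite leNgt; apply/negP => xi; move: Dtx; apply/negP.
  rewrite -leNgt /D subr_le0.
  have sq : rho ^+ 2 <= sqnorm x.
    apply: le_trans (sqr_coord_le x i).
    by rewrite -[X in _ <= X](real_normK (num_real _)) ler_sqr ?nnegrE// ltW.
  have ta : 0 <= t - a by rewrite subr_ge0; case/andP: tab.
  have h1 : w t x - expR (Q t) * H t x <= `|M|.
    rewrite (le_trans _ (ler_norm M))// lerBlDr (le_trans (wM t x tab))//.
    by rewrite lerDl mulr_ge0 ?expR_ge0// H0.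
  apply: (@le_trans _ _ `|M|).
    apply: (@le_trans _ _ (E t * `|M|)); first by rewrite ler_pM2l.
    by rewrite ler_piMl// /E -expR0 ler_expR oppr_le0 mulr_ge0.
  apply: (le_trans rhoM); rewrite /B ler_pM2l//.
  by rewrite (le_trans sq)// -addrA addrCA lerDl addr_ge0// mulr_ge0.
pose K : set (R * 'rV[R]_n) := [set` `[a, b]] `*`
    [set x : 'rV[R]_n | forall i, `|x 0 i| <= rho].
have cK : compact K.
  by apply: compact_setX; [exact: segment_compact|exact: compact_cube].
have cD : {within K, continuous (fun z => D z.1 z.2)}.
  apply: continuous_in_subspaceT => -[t x]; rewrite inE => -[/=].
  rewrite in_itv/= => tab _.
  set P := (R * 'rV[R]_n)%type.
  have c1 : {for (t, x) : P, continuous (fun z : P => z.1)} by exact: cvg_fst.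
  have ca : {for (t, x) : P, continuous (fun z : P => z.1 - a)}.
    by apply: continuousB => //; exact: cst_continuous.
  have cQ' : {for (t, x) : P, continuous (fun z : P => expR (Q z.1))}.
    apply: (@continuous_comp P R R (fun z => Q z.1) expR); last exact: continuous_expR.
    by apply: (@continuous_comp P R R fst Q) => //; exact: cQ.
  have cE : {for (t, x) : P, continuous (fun z : P => E z.1)}.
    apply: (@continuous_comp P R R (fun z => - (Lam * (z.1 - a))) expR); last exact: continuous_expR.
    by apply: continuousN; apply: continuousM => //; exact: cst_continuous.
  have cs : {for (t, x) : P, continuous (fun z : P => sqnorm z.2)}.
    apply: (@continuous_comp P 'rV[R]_n R snd (@sqnorm R n)); first exact: cvg_snd.
    exact: continuous_sqnorm.
  suff : {for (t, x) : P, continuous (fun z : P =>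
      E z.1 * (w z.1 z.2 - expR (Q z.1) * H z.1 z.2) -
      eta * (1 + sqnorm z.2 + c * (z.1 - a)))} by [].
  apply: continuousB.
    apply: continuousM => //; apply: continuousB; first exact: cw.
    by apply: continuousM => //; exact: cH.
  apply: continuousM; first exact: cst_continuous.
  apply: continuousD.
    by apply: continuousD => //; exact: cst_continuous.
  by apply: continuousM => //; exact: cst_continuous.
have K1 : K (t1, x1) by split => /=; [rewrite in_itv|exact: Dout D1].
have [|[t0 x0] /set_mem[/= t0ab x0K] Dmax] := compact_EVT_max _ cK cD.
  by exists (t1, x1).
move: t0ab; rewrite in_itv/= => t0ab.
have {}Dmax t x : a <= t <= b -> D t x <= D t0 x0.
  move=> tab; have [Dtx|] := ltrP 0 (D t x).
    apply: (Dmax (t, x)); rewrite inE; split => /=; first by rewrite in_itv.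
    exact: Dout Dtx.
  move=> h; apply: (le_trans h); apply/ltW/(lt_le_trans D1).
  by apply: (Dmax (t1, x1)); rewrite inE.
have D0 : 0 < D t0 x0 by apply: (lt_le_trans D1); exact: Dmax.
have at0 : a < t0.
  case/andP: t0ab; rewrite le_eqVlt => /predU1P[t0a _|//].
  move: D0; rewrite -t0a ltNge => /negP; case.
  rewrite /D /E /B subrr mulr0 oppr0 expR0 Qa expR0 !mul1r mulr0 addr0.
  by rewrite subr_le0 lerBlDl winit.
have t0b : t0 <= b by case/andP: t0ab.
have t0ab' : a < t0 <= b by rewrite at0.
pose C := expR (Q t0); pose k0 := kap t0.
have sub0 : C * H t0 x0 < w t0 x0.
  rewrite -subr_gt0 -(pmulr_rgt0 _ (E0 t0)); apply: (lt_trans D0).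
  rewrite /D gtrDl oppr_lt0 /B mulr_gt0//.
  rewrite -addrA ltr_pwDl// addr_ge0 ?sqnorm_ge0// mulr_ge0// subr_ge0 ltW//.
have wsub0 := wsub t0 x0 t0ab' sub0.
(* The function p is D at x0 with exp(Q(t)) replaced by its substitute; it is
   maximal from the left at t0, so its derivative there is nonnegative. *)
have dt : 0 <= E t0 * (derive1 (w ^~ x0) t0 - k0 * (C * H t0 x0) - C * laplacian (H t0) x0)
   - Lam * E t0 * (w t0 x0 - C * H t0 x0) - eta * c.
  pose p (t : R) := expR (- (Lam * (t - a))) * (w t x0 - C * expR (k0 * (t - t0)) * H t x0)
     - eta * (1 + sqnorm x0 + c * (t - a)).
  have dp : is_derive t0 1 p
     (E t0 * (derive1 (w ^~ x0) t0 - k0 * (C * H t0 x0) - C * laplacian (H t0) x0)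
      - Lam * E t0 * (w t0 x0 - C * H t0 x0) - eta * c).
    have h1 : is_derive t0 1 (w ^~ x0) (derive1 (w ^~ x0) t0).
      by rewrite derive1E; apply: derivableP; exact: wt.
    have h2 := Ht t0 x0 t0ab'.
    have gen (f g : R -> R) (f' g' m : R) :
      is_derive t0 1 f f' -> is_derive t0 1 g g' ->
      is_derive t0 1 (fun t => expR (- (Lam * (t - a))) *
        (f t - C * expR (k0 * (t - t0)) * g t) - eta * (m + c * (t - a)))
      (E t0 * (f' - k0 * (C * g t0) - C * g') - Lam * E t0 * (f t0 - C * g t0) - eta * c).
      move=> hf hg; apply: is_derive_eq.
      rewrite /GRing.scale/= subrr mulr0 expR0 /E.
      by move: (expR _) => e; ring.
    exact: (gen _ _ _ _ _ h1 h2).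
  apply: (derive_left_max_ge0 at0 dp).
  move=> t /andP[at_ tt0].
  have tab : a <= t <= b by rewrite at_ (le_trans tt0).
  have pt0 : p t0 = D t0 x0 by rewrite /p subrr mulr0 expR0 mulr1.
  rewrite pt0; apply: le_trans (Dmax t x0 tab).
  rewrite lerB// ler_pM2l ?expR_gt0// lerB// ler_wpM2r ?H0//.
  rewrite -expRD ler_expR.
  have := Qkap t t0 at_ tt0 t0b; rewrite -/k0; lra.
(* In each space direction D has a maximum at x0; 2 eta is the second
   derivative of the barrier. *)
have dx i : E t0 * ('D_(vec_e i) ('D_(vec_e i) (w t0)) x0 -
     C * 'D_(vec_e i) ('D_(vec_e i) (H t0)) x0) - 2 * eta <= 0.
  have d1 x : is_derive x (vec_e i) (D t0)
     (E t0 * ('D_(vec_e i) (w t0) x - C * 'D_(vec_e i) (H t0) x) - eta * (2 * x 0 i)).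
    have h1 : is_derive x (vec_e i) (w t0) ('D_(vec_e i) (w t0) x).
      by apply: derivableP; exact: wx.
    have h2 : is_derive x (vec_e i) (H t0) ('D_(vec_e i) (H t0) x).
      by apply: derivableP; exact: Hx.
    have h3 := is_derive_sqnorm x i.
    rewrite /D /B -/C; move: h1 h2 h3.
    move: (w t0) (H t0) (@sqnorm R n) => f g s h1 h2 h3.
    apply: is_derive_eq.
    by rewrite /GRing.scale/=; ring.
  have D1E : 'D_(vec_e i) (D t0) = (fun x =>
     E t0 * ('D_(vec_e i) (w t0) x - C * 'D_(vec_e i) (H t0) x) - eta * (2 * x 0 i)).
    by apply/funext => x; have h := d1 x; rewrite derive_val.
  have d2 : is_derive x0 (vec_e i) ('D_(vec_e i) (D t0))
     (E t0 * ('D_(vec_e i) ('D_(vec_e i) (w t0)) x0 -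
     C * 'D_(vec_e i) ('D_(vec_e i) (H t0)) x0) - 2 * eta).
    rewrite D1E.
    have h1 : is_derive x0 (vec_e i) ('D_(vec_e i) (w t0)) ('D_(vec_e i) ('D_(vec_e i) (w t0)) x0).
      by apply: derivableP; exact: wxx.
    have h2 : is_derive x0 (vec_e i) ('D_(vec_e i) (H t0)) ('D_(vec_e i) ('D_(vec_e i) (H t0)) x0).
      by apply: derivableP; exact: Hxx.
    have h3 := is_derive_coord x0 i.
    have gen (f g h : 'rV[R]_n -> R) (f' g' h' : R) :
      is_derive x0 (vec_e i) f f' -> is_derive x0 (vec_e i) g g' ->
      is_derive x0 (vec_e i) h h' ->
      is_derive x0 (vec_e i) (fun x => E t0 * (f x - C * g x) - eta * (2 * h x))
        (E t0 * (f' - C * g') - 2 * eta * h').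
      move=> hf hg hh; apply: is_derive_eq.
      by rewrite /GRing.scale/=; ring.
    rewrite -[2 * eta]mulr1.
    exact: (gen _ _ _ _ _ _ h1 h2 h3).
  have <- : 'D_(vec_e i) ('D_(vec_e i) (D t0)) x0 = E t0 *
    ('D_(vec_e i) ('D_(vec_e i) (w t0)) x0 -
     C * 'D_(vec_e i) ('D_(vec_e i) (H t0)) x0) - 2 * eta by rewrite derive_val.
  apply: derive2_max_le0.
  - by move=> x; case: (d1 x).
  - by case: d2.
  - by move=> y; exact: Dmax.
have dxs : E t0 * (laplacian (w t0) x0 - C * laplacian (H t0) x0) - 2 * eta * n%:R <= 0.
  have : \sum_(i < n) (E t0 * ('D_(vec_e i) ('D_(vec_e i) (w t0)) x0 -
     C * 'D_(vec_e i) ('D_(vec_e i) (H t0)) x0) - 2 * eta) <= 0.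
    by apply: sumr_le0 => i _; exact: dx.
  rewrite sumrB sumr_const card_ord -mulr_sumr sumrB -mulr_sumr.
  by rewrite -(mulr_natr (2 * eta)).
have := ler_wpM2l (ltW (E0 t0)) wsub0; rewrite -/C -/k0.
move: dt dxs; rewrite /c.
move: (E t0) (derive1 _ _) (laplacian _ _) (laplacian _ _) => e wt' lw lh.
move: (w t0 x0) (H t0 x0) => w0 h0; nra.
Qed.

End maximum_principle.

(** * Comparison with the heat semigroup *)

Section smooth_functions.
Context {R : realType} {n : nat}.
Implicit Types (T : \bar R) (u v w : R -> 'rV[R]_n -> R).

(** What the maximum principle uses of C^{2,1} regularity. *)
Definition smooth_on T u : Prop :=
  [/\ continuous_on_cylinder T u,
      (forall t x, cylinder T (t, x) -> derivable (u ^~ x) t 1),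
      (forall i t x, cylinder T (t, x) -> derivable (u t) x (vec_e i)) &
      (forall i t x, cylinder T (t, x) ->
         derivable ('D_(vec_e i) (u t)) x (vec_e i))].

Lemma C21_smooth T u : C21 T u -> smooth_on T u.
Proof.
move=> [cu [ut _] ux uxx]; split => //.
- by move=> t x tx; exact: (ut (t, x)).
- by move=> i t x tx; have [h _] := ux i; exact: (h (t, x)).
- by move=> i t x tx; have [h _] := uxx i i; exact: (h (t, x)).
Qed.

Lemma smooth0 T : smooth_on T (fun _ _ => 0).
Proof.
split.
- by move=> z _; exact: cst_continuous.
- by move=> t x _; exact: derivable_cst.
- by move=> i t x _; exact: derivable_cst.
- move=> i t x _.
  rewrite (_ : 'D_(vec_e i) (fun=> 0) = fun _ => 0); first exact: derivable_cst.
  by apply/funext => y; exact: derive_cst.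
Qed.

Lemma laplacianB (f g : 'rV[R]_n -> R) x :
  (forall i x, derivable f x (vec_e i)) -> (forall i x, derivable g x (vec_e i)) ->
  (forall i, derivable ('D_(vec_e i) f) x (vec_e i)) ->
  (forall i, derivable ('D_(vec_e i) g) x (vec_e i)) ->
  laplacian (fun x => f x - g x) x = laplacian f x - laplacian g x.
Proof.
move=> df dg ddf ddg; rewrite /laplacian -sumrB; apply: eq_bigr => i _.
rewrite (_ : 'D_(vec_e i) (fun x => f x - g x) =
   'D_(vec_e i) f - 'D_(vec_e i) g); last first.
  by apply/funext => y; exact: deriveB.
exact: deriveB.
Qed.

Lemma smoothB T u v : smooth_on T u -> smooth_on T v ->
  smooth_on T (fun t x => u t x - v t x).
Proof.
move=> [cu ut ux uxx] [cv vt vx vxx]; split.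
- by move=> z zT; apply: continuousB; [exact: cu|exact: cv].
- by move=> t x tx; apply: derivableB; [exact: ut|exact: vt].
- by move=> i t x tx; apply: derivableB; [exact: ux|exact: vx].
- move=> i t x tx.
  rewrite (_ : 'D_(vec_e i) (fun x => u t x - v t x) =
   'D_(vec_e i) (u t) - 'D_(vec_e i) (v t)).
    by apply: derivableB; [exact: uxx|exact: vxx].
  by apply/funext => y; apply: deriveB; [exact: ux|exact: vx].
Qed.

Lemma heat_operatorB T u v t x : smooth_on T u -> smooth_on T v ->
  cylinder T (t, x) ->
  derive1 (fun t => u t x - v t x) t - laplacian (fun x => u t x - v t x) x =
  (derive1 (u ^~ x) t - laplacian (u t) x) - (derive1 (v ^~ x) t - laplacian (v t) x).
Proof.
move=> [cu ut ux uxx] [cv vt vx vxx] tx.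
have e1 : derive1 (fun t => u t x - v t x) t =
    derive1 (u ^~ x) t - derive1 (v ^~ x) t.
  by rewrite !derive1E; apply: deriveB; [exact: ut|exact: vt].
have e2 : laplacian (fun x => u t x - v t x) x =
    laplacian (u t) x - laplacian (v t) x.
  exact: (laplacianB (fun i y => ux i t y tx) (fun i y => vx i t y tx)
    (fun i => uxx i t x tx) (fun i => vxx i t x tx)).
rewrite e1 e2; move: (derive1 _ _) (derive1 _ _) (laplacian _ _) (laplacian _ _).
by move=> p q r s; ring.
Qed.

Lemma continuous_pair (A B C : topologicalType) (f : A -> B) (h : A -> C) (x : A) :
  {for x, continuous f} -> {for x, continuous h} ->
  {for x, continuous (fun x => (f x, h x))}.
Proof. by move=> cf ch; exact: (cvg_pair cf ch). Qed.

Lemma smooth_continuous T u t : smooth_on T u -> 0 < t -> (t%:E < T)%E ->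
  continuous (u t).
Proof.
move=> [cu _ _ _] t0 tT x.
have h := cu (t, x) (conj t0 tT).
apply: (@continuous_comp 'rV[R]_n (R * 'rV[R]_n)%type R (fun x => (t, x))
  (fun z => u z.1 z.2)) => //.
by apply: continuous_pair; [exact: cst_continuous|exact: cvg_id].
Qed.

End smooth_functions.

Section heat_comparison.
Context {R : realType} {n : nat}.
Local Notation mu := (@lebesgue_rV R n).
Variables (T : \bar R) (w : R -> 'rV[R]_n -> R) (g : 'rV[R]_n -> R) (a b M : R).
Hypotheses (w_smooth : smooth_on T w) (a0 : 0 < a) (ab : a < b) (bT : (b%:E < T)%E).
Hypothesis wM : forall t x, a <= t <= b -> w t x <= M.
Hypotheses (ig : mu.-integrable setT (EFin \o g)) (cg : continuous g)
  (g0 : forall x, 0 <= g x) (gM : forall x, g x <= M) (wg : forall x, w a x <= g x).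

Let cyl t (x : 'rV[R]_n) : a <= t <= b -> cylinder T (t, x).
Proof.
move=> /andP[at_ tb]; split => /=; first exact: lt_le_trans at_.
by apply: le_lt_trans bT; rewrite lee_fin.
Qed.

Let cyl' t (x : 'rV[R]_n) : a < t <= b -> cylinder T (t, x).
Proof. by move=> /andP[/ltW at_ tb]; apply: cyl; rewrite at_. Qed.

(** The convolution is run ahead by delta, so that it is smooth up to the initial
time a. There it still lies above w: on a large cube by [heat_conv_initial], and
outside of it because eta |x|^2 exceeds the bound M. The coefficients kap and Q
are chosen after delta, since in the a priori estimate they follow the shifted
time. *)
Lemma heat_comparison_shift (eta : R) : 0 < eta ->
  exists2 delta0, 0 < delta0 & forall (delta Lam : R) (kap Q : R -> R),
  0 < delta < delta0 -> 0 <= Lam ->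
  (forall t, a <= t <= b -> {for t, continuous Q}) ->
  (forall s t, a <= s -> s <= t -> t <= b -> kap t * (t - s) <= Q t - Q s) ->
  Q a = 0 ->
  (forall t x, a < t <= b -> expR (Q t) * heat_conv g (t - a + delta) x < w t x ->
    derive1 (w ^~ x) t - laplacian (w t) x <=
      kap t * (expR (Q t) * heat_conv g (t - a + delta) x) +
      Lam * (w t x - expR (Q t) * heat_conv g (t - a + delta) x)) ->
  forall t x, a <= t <= b ->
    w t x <= expR (Q t) * heat_conv g (t - a + delta) x +
      expR (Lam * (t - a)) * (eta * (1 + sqnorm x + (2 * n%:R + 1) * (t - a))).
Proof.
move=> eta0; have M0 : 0 <= M by apply: le_trans (g0 0) _.
pose rho := Num.max 1 (M / eta).
have rho1 : 1 <= rho by rewrite le_max lexx.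
have rho0 : 0 <= rho by exact: le_trans rho1.
have rhoM : M <= eta * rho ^+ 2.
  rewrite mulrC -ler_pdivrMr//; apply: (@le_trans _ _ rho).
    by rewrite le_max lexx orbT.
  by rewrite expr2 ler_peMr.
have [delta0 d0 dP] := heat_conv_initial ig g0 gM cg (@compact_cube R n rho) eta0.
exists delta0 => // delta Lam kap Q dd Lam0 cQ Qkap Qa wsub.
have delta_gt0 : 0 < delta by case/andP: dd.
have spos t : a <= t -> 0 < t - a + delta by move=> at_; rewrite ltr_wpDl// subr_ge0.
have [cw wt wx wxx] := w_smooth.
apply: (@maximum_principle R n w (fun t x => heat_conv g (t - a + delta) x) kap Q
  a b Lam M eta) => //.
- by move=> t x tab; have := cw (t, x) (cyl x tab).
- move=> t x /andP[at_ _]; set P := (R * 'rV[R]_n)%type.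
  apply: (@continuous_comp P P R (fun z => (z.1 - a + delta, z.2))
    (fun z => heat_conv g z.1 z.2)); last first.
    by apply: continuous_heat_conv => //=; exact: spos.
  have h1 : {for (t, x) : P, continuous (fun z : P => z.1 - a + delta)}.
    apply: continuousD; last exact: cst_continuous.
    by apply: continuousB; [exact: cvg_fst|exact: cst_continuous].
  by apply: continuous_pair; [exact: h1|exact: cvg_snd].
- by move=> t x tab; exact/wt/cyl'.
- by move=> t x i tab; exact/wx/cyl'.
- by move=> t x i tab; exact/wxx/cyl'.
- move=> t x /andP[/ltW at_ _].
  have h1 := heat_equation ig x (spos t at_).
  have h2 : is_derive t 1 (fun t => t - a + delta) 1.
    by apply: is_derive_eq; rewrite oppr0 !addr0.
  have := is_derive1_comp (g := fun t => t - a + delta) h1 h2.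
  by rewrite mulr1.
- by move=> t x i /andP[/ltW at_ _]; apply: derivable_heat_conv => //; exact: spos.
- by move=> t x i /andP[/ltW at_ _]; apply: derivable2_heat_conv => //; exact: spos.
- by move=> t x /andP[at_ _]; exact: heat_conv_ge0.
- move=> x; rewrite subrr add0r; apply: (le_trans (wg x)).
  have [xr|] := pselect (forall i, `|x 0 i| <= rho).
    apply: (le_trans (dP delta x dd xr)); rewrite lerD2l.
    by rewrite ler_peMr ?lerDl ?sqnorm_ge0// ltW.
  move=> /existsNP[i /negP]; rewrite -ltNge => xi.
  have sq : rho ^+ 2 <= sqnorm x.
    apply: le_trans (sqr_coord_le x i).
    by rewrite -[X in _ <= X](real_normK (num_real _)) ler_sqr ?nnegrE// ltW.
  apply: (le_trans (gM x)); apply: (le_trans rhoM).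
  apply: (@le_trans _ _ (eta * (1 + sqnorm x))).
    by rewrite ler_pM2l// (le_trans sq)// lerDr.
  by rewrite lerDr heat_conv_ge0.
Qed.

(** In the linear case the error terms of [heat_comparison_shift] can be removed,
letting eta and then delta tend to 0. *)
Lemma heat_comparison (kap Q : R -> R) :
  (forall t, a <= t <= b -> {for t, continuous Q}) ->
  (forall s t, a <= s -> s <= t -> t <= b -> kap t * (t - s) <= Q t - Q s) ->
  Q a = 0 ->
  (exists Lam, forall t, a <= t <= b -> kap t <= Lam) ->
  (forall t x, a < t <= b -> 0 < w t x ->
    derive1 (w ^~ x) t - laplacian (w t) x <= kap t * w t x) ->
  forall t x, a < t <= b -> w t x <= expR (Q t) * heat_conv g (t - a) x.
Proof.
move=> cQ Qkap Qa [Lam' LamP] wsub t x tab.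
pose Lam := Num.max 0 Lam'.
have Lam0 : 0 <= Lam by rewrite le_max lexx.
have kLam s : a <= s <= b -> kap s <= Lam.
  by move=> /LamP /le_trans; apply; rewrite le_max lexx orbT.
have ta : 0 < t - a by rewrite subr_gt0; case/andP: tab.
rewrite leNgt; apply/negP => gap.
set z0 := expR (Q t) * _ in gap; pose gam := (w t x - z0) / 2.
have gam0 : 0 < gam by rewrite divr_gt0// subr_gt0.
pose A := expR (Lam * (t - a)) * (1 + sqnorm x + (2 * n%:R + 1) * (t - a)).
have A0 : 0 < A.
  rewrite mulr_gt0 ?expR_gt0// -addrA ltr_pwDl// addr_ge0 ?sqnorm_ge0//.
  by rewrite mulr_ge0 ?(ltW ta)// addr_ge0// mulr_ge0.
have eta0 : 0 < gam / A by rewrite divr_gt0.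
have [d0 d00 dP] := heat_comparison_shift eta0.
have cH : {for t - a, continuous (heat_conv g ^~ x)}.
  have [D _] := heat_equation ig x ta.
  by apply: differentiable_continuous; exact/derivable1_diffP.
have e0 : 0 < gam / expR (Q t) by rewrite divr_gt0 ?expR_gt0.
have /cvgrPdist_lt/(_ _ e0)/nbhs_ballP[r /= r0 rP] := cH.
pose d := Num.min (r / 2) (d0 / 2).
have d_gt0 : 0 < d by rewrite lt_min !divr_gt0.
have dd0 : d < d0 by rewrite gt_min [X in _ || X]ltr_pdivrMr// mulr_natr mulr2n ltrDl d00 orbT.
have dr : d < r by rewrite gt_min ltr_pdivrMr// mulr_natr mulr2n ltrDl r0.
have ws s y : a < s <= b -> expR (Q s) * heat_conv g (s - a + d) y < w s y ->
    derive1 (w ^~ y) s - laplacian (w s) y <=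
      kap s * (expR (Q s) * heat_conv g (s - a + d) y) +
      Lam * (w s y - expR (Q s) * heat_conv g (s - a + d) y).
  move=> sab sy.
  have z1 : 0 <= expR (Q s) * heat_conv g (s - a + d) y.
    by rewrite mulr_ge0 ?expR_ge0 ?heat_conv_ge0.
  have sab' : a <= s <= b by case/andP: sab => /ltW -> ->.
  apply: (le_trans (wsub s y sab (le_lt_trans z1 sy))).
  have := kLam s sab'; move: sy z1; move: (expR _ * _) => z sy z1 kl.
  nra.
have tab' : a <= t <= b by case/andP: tab => /ltW -> ->.
have dd : 0 < d < d0 by rewrite d_gt0.
have := dP d Lam kap Q dd Lam0 cQ Qkap Qa ws t x tab'.
have : `|heat_conv g (t - a) x - heat_conv g (t - a + d) x| < gam / expR (Q t).
  by apply: rP; rewrite /ball/= opprD addrA subrr sub0r normrN gtr0_norm.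
rewrite ltr_norml => /andP[hl hr].
have hc : heat_conv g (t - a + d) x < gam / expR (Q t) + heat_conv g (t - a) x.
  by rewrite -ltrBlDr -opprB ltrNl.
have h2 : expR (Q t) * heat_conv g (t - a + d) x < z0 + gam.
  rewrite mulrC -ltr_pdivlMr ?expR_gt0//.
  apply: (lt_le_trans hc); rewrite mulrDl /z0 mulrC.
  by rewrite [_ * heat_conv _ _ _]mulrC mulfK ?gt_eqF ?expR_gt0// addrC.
have -> : expR (Lam * (t - a)) *
  (gam / A * (1 + sqnorm x + (2 * n%:R + 1) * (t - a))) = gam.
  by rewrite mulrCA -/A divfK// gt_eqF.
rewrite leNgt => /negP; apply.
have -> : w t x = z0 + gam + gam by rewrite /gam; field.
by rewrite ltrD2r.
Qed.

End heat_comparison.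

(** * The Lipschitz constant on bounded intervals *)

Section lip_const_theory.
Context {R : realType}.
Variable f : R -> R.
Hypotheses (f_lip : [locally [lipschitz f x | x in [set: R]]])
  (f_homo : {homo f : x y / x <= y}).

(** Local Lipschitz bounds hold near each point of the compact square of side
2 s, including the points of its diagonal; finitely many of them suffice. *)
Lemma lipschitz_segment (s : R) : exists M : R, forall u v, `|u| <= s -> `|v| <= s ->
  `|f u - f v| <= M * `|u - v|.
Proof.
pose K : set (R * R) := `[- s, s]%classic `*` `[- s, s]%classic.
have cK : compact K by apply: compact_setX; exact: segment_compact.
move/compact_near_coveringP : cK => /(_ R +oo%R
  (fun M z => `|f z.1 - f z.2| <= M * `|z.1 - z.2|) _).
case=> [z _|M [_ MP]].
  have := @f_lip z (conj I I) => -[M0 [_ M0P]].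
  have {}M0P := M0P (M0 + 1) (ltr_pwDr ltr01 (lexx _)).
  exists ([set z | `|f z.1 - f z.2| <= (M0 + 1) * `|z.1 - z.2|], [set M | M0 + 1 <= M]).
    split => /=; last by exists (M0 + 1); split; [exact: num_real|move=> x /ltW].
    move: M0P; rewrite /dominated_by /within/=.
    by apply: filterS => y; apply.
  by move=> [y M] /= [h1 h2]; apply: (le_trans h1); rewrite ler_wpM2r.
exists (M + 1) => u v us vs.
by apply: (MP (M + 1) _ (u, v)); [rewrite ltrDl|split; rewrite /= in_itv/= -ler_norml].
Qed.

Let quot (s : R) := [set y | exists u v, [/\ `|u| <= s, `|v| <= s, u != v &
                                 y = (f u - f v) / (u - v)]].

Let quot_ub s : has_ubound (quot s).
Proof.
have [M MP] := lipschitz_segment s; exists M => _ [u [v [us vs uv ->]]].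
apply: (le_trans (ler_norm _)); rewrite normf_div ler_pdivrMr; last first.
  by rewrite normr_gt0 subr_eq0.
exact: MP.
Qed.

Lemma lip_constP s u v : `|u| <= s -> `|v| <= s -> v <= u ->
  f u - f v <= lip_const f s * (u - v).
Proof.
move=> us vs; rewrite le_eqVlt => /predU1P[->|vu]; first by rewrite !subrr mulr0.
have s0 : 0 < s.
  rewrite lt_neqAle (le_trans _ us)// andbT; apply/eqP => s0.
  by move: us vs vu; rewrite -s0 !normr_le0 => /eqP -> /eqP ->; rewrite ltxx.
rewrite -ler_pdivrMr ?subr_gt0// /lip_const s0.
apply: ub_le_sup; first exact: quot_ub.
by exists u, v; split => //; rewrite gt_eqF.
Qed.

Lemma lip_const_ge0 s : 0 <= lip_const f s.
Proof.
rewrite /lip_const; case: ifPn => // s0.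
apply: (@le_trans _ _ ((f s - f (- s)) / (s - - s))).
  have Ns : - s <= s by rewrite (@le_trans _ _ 0)// ?oppr_le0 ltW.
  by apply: divr_ge0; rewrite subr_ge0//; exact: f_homo.
apply: ub_le_sup; first exact: quot_ub.
exists s, (- s); split => //; rewrite ?normrN ?gtr0_norm//.
by rewrite gt_eqF// (@lt_trans _ _ 0)// oppr_lt0.
Qed.

Lemma lip_const_homo : {homo lip_const f : s t / s <= t}.
Proof.
move=> s t st; have [s0|s0] := ltrP 0 s; last first.
  by rewrite {1}/lip_const ltNge s0/= lip_const_ge0.
rewrite /lip_const s0 (lt_le_trans s0 st); apply: sup_le_ub.
- exists ((f s - f (- s)) / (s - - s)), s, (- s).
  by split => //; rewrite ?normrN ?gtr0_norm// gt_eqF// (@lt_trans _ _ 0)// oppr_lt0.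
- move=> y [u [v [us vs uv yE]]]; apply: ub_le_sup; first exact: quot_ub.
  by exists u, v; split => //; [exact: le_trans st|exact: le_trans st].
Qed.

End lip_const_theory.

(** * The integral condition on the Lipschitz constant *)

Section tail_integral.
Context {R : realType}.
Local Notation leb := (@lebesgue_measure R).
Variable h : R -> R.
Hypothesis ih : leb.-integrable `[1, +oo[ (EFin \o h).
Hypothesis h0 : forall s, 1 <= s -> 0 <= h s.

Definition tail (A : R) : R := \int[leb]_(s in `[A, +oo[) h s.

Let ihS A : 1 <= A -> leb.-integrable `[A, +oo[ (EFin \o h).
Proof.
move=> A1; apply: integrableS ih => //.
by move=> s /=; rewrite !in_itv/= !andbT; exact: le_trans.
Qed.

Lemma integrable_segment A B : 1 <= A -> leb.-integrable `[A, B] (EFin \o h).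
Proof.
move=> A1; apply: integrableS ih => //.
by move=> s /=; rewrite !in_itv/= !andbT => /andP[As _]; exact: le_trans As.
Qed.

Lemma tailB A B : 1 <= A -> A <= B -> tail A - tail B = \int[leb]_(s in `[A, B]) h s.
Proof.
move=> A1 AB.
have iAB : leb.-integrable `[A, B[ (EFin \o h).
  by apply: integrableS (integrable_segment B A1) => // s /=; exact: subset_itv_co_cc.
rewrite -Rintegral_itv_bndo_bndc//.
rewrite /tail; apply/eqP; rewrite subr_eq; apply/eqP.
have e : `[A, +oo[%classic = `[A, B[%classic `|` `[B, +oo[%classic.
  by rewrite -itv_bndbnd_setU// bnd_simp.
rewrite e Rintegral_setU//.
  by rewrite -e; exact: ihS.
apply/disj_setPS => s [/=]; rewrite !in_itv/= andbT => /andP[_ sB] Bs.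
by move: (lt_le_trans sB Bs); rewrite ltxx.
Qed.

Lemma tail_ge0 A : 1 <= A -> 0 <= tail A.
Proof.
move=> A1; apply: Rintegral_ge0 => s /=; rewrite in_itv/= andbT => As.
exact/h0/(le_trans A1).
Qed.

(** The integrals over [1, N] converge to the integral over [1, oo[. *)
Lemma tail_cvg0 e : 0 < e -> exists2 A, 1 < A & forall B, A <= B -> tail B < e.
Proof.
move=> e0.
have FU : \bigcup_(i : nat) `[1, i%:R + 2 : R]%classic = `[1, +oo[%classic.
  apply/seteqP; split => [x [i _]|x] /=; rewrite !in_itv/= ?andbT.
    by case/andP.
  move=> x1; exists (Num.truncn x) => //=; rewrite in_itv/= x1/=.
  have := truncnS_gt x; rewrite -natr1 => /ltW/le_trans; apply.
  by rewrite lerD2l ler1n.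
have cv : (\int[leb]_(x in `[1%R, (i%:R + 2)%R]) (h x)%:E)%E @[i --> \oo] -->
    (\int[leb]_(x in `[1%R, +oo[) (h x)%:E)%E.
  rewrite -FU; apply: ge0_nondecreasing_set_cvg_integral => //=.
  - move=> i j ij; apply/subsetPset; apply: subset_itvl; rewrite bnd_simp.
    by rewrite lerD2r ler_nat.
  - by move=> i; apply: (@measurable_int _ _ _ leb); exact: integrable_segment.
  - by move=> i x /=; rewrite in_itv/= => /andP[x1 _]; rewrite lee_fin h0.
have {cv} : (\int[leb]_(x in `[1, (i%:R + 2)]) h x)%R @[i --> \oo] --> tail 1.
  apply: fine_cvg; rewrite fineK//; exact: integrable_fin_num ih.
move=> /cvgrPdist_lt/(_ _ e0)[i _ /(_ i (leqnn i))] /= hi.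
exists (i%:R + 2); first by rewrite ltr_wpDl// ltr1n.
move=> B iB.
have i1 : 1 <= i%:R + 2 :> R by rewrite ler_wpDl// ler1n.
apply: (@le_lt_trans _ _ (tail (i%:R + 2))).
  rewrite -subr_ge0 tailB//; apply: Rintegral_ge0 => s /=.
  by rewrite in_itv/= => /andP[As _]; exact/h0/(le_trans i1).
apply: le_lt_trans hi; rewrite (le_trans _ (ler_norm _))//.
by rewrite -(tailB (lexx 1) i1); lra.
Qed.

End tail_integral.

Section power_integral.
Context {R : realType}.
Local Notation leb := (@lebesgue_measure R).

Lemma continuous_powR (a x : R) : 0 < x -> {for x, continuous (fun y : R => y `^ a)}.
Proof.
move=> x0; have [D _] := is_derive1_powR a x0.
by apply: differentiable_continuous; exact/derivable1_diffP.
Qed.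

Lemma integral_powR (q A B : R) : 0 < q -> 0 < A -> A < B ->
  (\int[leb]_(s in `[A, B]) (s `^ (- (1 + q)))%:E =
    (q^-1 * (A `^ (- q) - B `^ (- q)))%:E)%E.
Proof.
move=> q0 A0 AB; have B0 := lt_trans A0 AB.
pose F (s : R) := - q^-1 * s `^ (- q).
have dF (s : R) : 0 < s -> is_derive s 1 F (s `^ (- (1 + q))).
  move=> s0; have h := is_derive1_powR (- q) s0.
  have h2 : is_derive s 1 F (- q^-1 *: (- q * s `^ (- q - 1))) by exact: is_deriveZ.
  apply: (is_derive_eq h2).
  rewrite /GRing.scale/= mulrA mulrNN mulVf ?gt_eqF// mul1r.
  by rewrite opprD addrC.
have cF (s : R) : 0 < s -> {for s, continuous F}.
  move=> s0; have [D _] := dF s s0.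
  by apply: differentiable_continuous; exact/derivable1_diffP.
rewrite (@continuous_FTC2 _ _ F)//.
- by rewrite -EFinB /F; congr EFin; ring.
- apply: continuous_in_subspaceT => s; rewrite inE/= in_itv/= => /andP[As _].
  by apply: continuous_powR; exact: lt_le_trans As.
- split.
  + move=> s; rewrite in_itv/= => /andP[As _].
    by have [] := dF s (lt_trans A0 As).
  + exact/cvg_at_right_filter/cF.
  + exact/cvg_at_left_filter/cF.
- move=> s; rewrite in_itv/= => /andP[As _].
  by rewrite derive1E; have h := dF s (lt_trans A0 As); rewrite derive_val.
Qed.

End power_integral.

Section growth.
Context {R : realType}.
Local Notation leb := (@lebesgue_measure R).
Variables (n : nat) (f : R -> R).
Hypotheses (n0 : (0 < n)%N)
  (f_lip : [locally [lipschitz f x | x in [set: R]]])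
  (f_homo : {homo f : x y / x <= y})
  (f_int : (\int[leb]_(s in `[1%R, +oo[)
     (s `^ (- (1 + 2 / n%:R)) * lip_const f s)%:E < +oo)%E).

Let q : R := 2 / n%:R.
Let q0 : 0 < q. Proof. by rewrite divr_gt0 ?ltr0n. Qed.
Let L := lip_const f.
Let L0 s : 0 <= L s. Proof. exact: lip_const_ge0. Qed.
Let Lhomo s t : s <= t -> L s <= L t. Proof. exact: lip_const_homo. Qed.

Definition growth_integrand (s : R) := s `^ (- (1 + 2 / n%:R)) * lip_const f s.
Local Notation h := growth_integrand.

Let h0 s : 1 <= s -> 0 <= h s.
Proof. by move=> _; rewrite mulr_ge0// powR_ge0. Qed.

Let mh (D : set R) : measurable D -> measurable_fun D h.
Proof.
move=> mD; apply: measurable_funM; last exact: nondecreasing_measurable.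
apply: (measurable_funS measurableT) => //; exact: measurable_powR.
Qed.

Let ih : leb.-integrable `[1, +oo[ (EFin \o h).
Proof.
apply/integrableP; split; first by apply/measurable_EFinP; exact: (mh (measurable_itv _)).
apply: le_lt_trans f_int; apply: ge0_le_integral => //.
- by apply: measurableT_comp => //; apply/measurable_EFinP; exact: (mh (measurable_itv _)).
- by apply/measurable_EFinP; exact: (mh (measurable_itv _)).
- by move=> s /=; rewrite in_itv/= andbT => s1; rewrite ger0_norm ?h0.
Qed.

Local Notation tail := (tail h).

Let tail_lower A B : 1 <= A -> A <= B ->
  L A * (q^-1 * (A `^ (- q) - B `^ (- q))) <= tail A - tail B.
Proof.
move=> A1; rewrite le_eqVlt => /predU1P[->|AB].
  by rewrite !subrr !mulr0.
have A0 : 0 < A by exact: lt_le_trans A1.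
rewrite (tailB ih)//; last exact: ltW.
rewrite -lee_fin /Rintegral fineK; last first.
  exact/integrable_fin_num/(integrable_segment ih).
rewrite EFinM -(integral_powR q0 A0 AB) -ge0_integralZl//.
- apply: ge0_le_integral => //.
  + by move=> s _; rewrite lee_fin mulr_ge0// powR_ge0.
  + apply/measurable_EFinP/measurable_funM => //.
    by apply: (measurable_funS measurableT) => //; exact: measurable_powR.
  + by apply/measurable_EFinP; exact: (mh (measurable_itv _)).
  + move=> s /=; rewrite in_itv/= => /andP[As sB].
    rewrite lee_fin /h mulrC ler_wpM2l ?powR_ge0//; exact: Lhomo.
- apply/measurable_EFinP.
  by apply: (measurable_funS measurableT) => //; exact: measurable_powR.
- by move=> s _; rewrite lee_fin powR_ge0.
- by rewrite lee_fin.
Qed.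

Let tail_upper A B : 1 <= A -> A <= B -> tail A - tail B <= L B * (B - A).
Proof.
move=> A1 AB; rewrite (tailB ih)//.
rewrite -lee_fin /Rintegral fineK; last first.
  exact/integrable_fin_num/(integrable_segment ih).
have -> : (L B * (B - A))%:E = (\int[leb]_(s in `[A, B]) (L B)%:E)%E.
  rewrite integral_cst//= lebesgue_measure_itv/= lte_fin.
  move: AB; rewrite le_eqVlt => /predU1P[->|->]; last by rewrite -EFinB -EFinM.
  by rewrite ltxx subrr mulr0 mule0.
apply: ge0_le_integral => //.
- move=> s /=; rewrite in_itv/= => /andP[As _]; rewrite lee_fin.
  exact/h0/(le_trans A1).
- by apply/measurable_EFinP; exact: (mh (measurable_itv _)).
- move=> s /=; rewrite in_itv/= => /andP[As sB]; rewrite lee_fin /h.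
  apply: (@le_trans _ _ (1 * L s)); last by rewrite mul1r; exact: Lhomo.
  rewrite ler_wpM2r//; have s1 := le_trans A1 As.
  rewrite -[leRHS](powRr0 s) ler_powR//.
Qed.

Let tail_continuous A : 1 < A -> {for A, continuous tail}.
Proof.
move=> A1; apply/cvgrPdist_lt => e e0.
have C0 : 0 < L (A + 1) + 1 by rewrite ltr_wpDl.
near=> B.
have B1 : 1 <= B by apply/ltW; near: B; exact: lt_nbhsr.
have BA1 : B <= A + 1 by apply/ltW; near: B; apply: lt_nbhsl; rewrite ltrDl.
have dAB : `|A - B| < e / (L (A + 1) + 1).
  near: B; have ec : 0 < e / (L (A + 1) + 1) by rewrite divr_gt0.
  exact: (nbhsx_ballx A _ ec).
have key X Y : 1 <= X -> X <= Y -> Y <= A + 1 -> `|X - Y| < e / (L (A + 1) + 1) ->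
    `|tail X - tail Y| < e.
  move=> X1 XY YA XYe; rewrite ger0_norm; last first.
    apply: le_trans (tail_lower X1 XY).
    rewrite mulr_ge0// mulr_ge0 ?invr_ge0 ?(ltW q0)// subr_ge0 !powRN.
    rewrite lef_pV2 ?posrE ?powR_gt0 ?(lt_le_trans _ X1)// ?(lt_le_trans _ (le_trans X1 XY))//.
    by rewrite ge0_ler_powR ?(ltW q0)// ?nnegrE ?(le_trans ler01)// (le_trans X1).
  apply: (le_lt_trans (tail_upper X1 XY)).
  move: XYe; rewrite ltr_pdivlMr// distrC ger0_norm ?subr_ge0// mulrC; apply: le_lt_trans.
  by rewrite ler_wpM2r ?subr_ge0// (le_trans (Lhomo YA))// lerDl.
have [AB|BA] := lerP A B.
  by apply: key => //; exact: ltW.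
rewrite distrC; apply: key => //; first exact: ltW.
  by rewrite lerDl.
by rewrite distrC.
Unshelve. all: by end_near. Qed.

(** A solution will be bounded by this level at the time t. It is also the value
of s that corresponds to t when the integral of L(K t^(-n/2)) in t is
transformed into an integral of s^(-(1 + 2/n)) L(s). *)
Definition scale_level (K t : R) := K * t `^ (- (n%:R / 2)).
Definition growth_rate (K t : R) := lip_const f (scale_level K t).
(** After the substitution s = K r^(-n/2), this is the integral of [growth_rate K]
over r in ]0, t[. Written as a tail integral it is finite, continuous in t, and
tends to 0 with t. *)
Definition growth (K t : R) := q * K `^ q * tail (scale_level K t).

Lemma scale_level_homo K s t : 0 <= K -> 0 < s -> s <= t ->
  scale_level K t <= scale_level K s.
Proof.
move=> K0 s0 st; have t0 := lt_le_trans s0 st.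
rewrite ler_wpM2l// !powRN lef_pV2 ?posrE ?powR_gt0//.
by rewrite ge0_ler_powR ?nnegrE ?(ltW s0) ?(ltW t0)// divr_ge0.
Qed.

Let levelX K t : 0 < K -> 0 < t -> scale_level K t `^ (- q) = K `^ (- q) * t.
Proof.
move=> K0 t0; rewrite /scale_level powRM ?powR_ge0 ?(ltW K0)//; congr (_ * _).
rewrite -powRrM mulrNN /q mulrC.
have -> : 2 / n%:R * (n%:R / 2) = 1 :> R.
  by field; rewrite pnatr_eq0 -lt0n.
by rewrite powRr1// ltW.
Qed.

(** On the interval between the levels of t and s, L is at least its value at the
level of t, as L is nondecreasing, and there the weight s^(-(1 + 2/n))
integrates to (n/2) K^(-2/n) (t - s). *)
Lemma growthB K s t : 0 < K -> 0 < s -> s <= t -> 1 <= scale_level K t ->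
  growth_rate K t * (t - s) <= growth K t - growth K s.
Proof.
move=> K0 s0 st lt1; have t0 := lt_le_trans s0 st.
have := tail_lower lt1 (scale_level_homo (ltW K0) s0 st).
rewrite !levelX// -mulrBr -mulrBr.
have c0 : 0 < q * K `^ q by rewrite mulr_gt0// powR_gt0.
rewrite -(ler_pM2l c0); apply: le_trans.
rewrite /growth_rate -/L; set l := L _.
rewrite [leRHS](_ : _ = l * (t - s) * ((q / q) * (K `^ q * K `^ (- q)))); last by ring.
by rewrite divff ?gt_eqF// powRN divff ?mulr1// gt_eqF// powR_gt0.
Qed.

Lemma growth_ge0 K t : 0 < K -> 1 <= scale_level K t -> 0 <= growth K t.
Proof.
move=> K0 l1; rewrite !mulr_ge0 ?powR_ge0 ?(ltW q0)//.
exact: tail_ge0.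
Qed.

Lemma growth_continuous K t : 0 < t -> 1 < scale_level K t ->
  {for t, continuous (growth K)}.
Proof.
move=> t0 l1; apply: continuousM; first exact: cst_continuous.
apply: (@continuous_comp _ _ _ (scale_level K) tail); last exact: tail_continuous.
apply: continuousM; first exact: cst_continuous.
exact: continuous_powR.
Qed.

Lemma growth_small K e : 0 < K -> 0 < e ->
  exists2 t0, 0 < t0 & forall t, 0 < t <= t0 -> 1 < scale_level K t /\ growth K t < e.
Proof.
move=> K0 e0; have c0 : 0 < q * K `^ q by rewrite mulr_gt0// powR_gt0.
have ec : 0 < e / (q * K `^ q) by rewrite divr_gt0.
have [A A1 AP] := tail_cvg0 ih h0 ec.
have A0 : 0 < A by exact: lt_trans A1.
have N0 : 0 < n%:R / 2 :> R by rewrite divr_gt0 ?ltr0n.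
exists ((A / K) `^ (- q)); first by rewrite powR_gt0// divr_gt0.
move=> t /andP[t0 tA].
have lA : A <= scale_level K t.
  rewrite /scale_level mulrC -ler_pdivrMr//.
  have AK0 : 0 < A / K by rewrite divr_gt0.
  rewrite powRN -[leLHS]invrK lef_pV2 ?posrE ?powR_gt0 ?invr_gt0//.
  have : t `^ (n%:R / 2) <= ((A / K) `^ (- q)) `^ (n%:R / 2).
    by rewrite ge0_ler_powR ?nnegrE ?(ltW N0) ?(ltW t0) ?powR_ge0.
  move=> /le_trans; apply; rewrite -powRrM mulNr /q.
  have -> : 2 / n%:R * (n%:R / 2) = 1 :> R by field; rewrite pnatr_eq0 -lt0n.
  by rewrite powR_inv1 ?(ltW AK0).
split; first exact: lt_le_trans lA.
by rewrite /growth mulrC -ltr_pdivlMr// AP.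
Qed.

Lemma growth_cvg0 K : 0 < K -> growth K t @[t --> 0^'+] --> 0.
Proof.
move=> K0; apply/cvgrPdist_lt => e e0.
have [t0 t00 tP] := growth_small K0 e0.
near=> t.
have [|l1 ge] := tP t.
  by apply/andP; split; [near: t; exact: nbhs_right_gt|near: t; exact: nbhs_right_le].
by rewrite sub0r normrN ger0_norm// growth_ge0// ltW.
Unshelve. all: by end_near. Qed.

End growth.

(** * From almost everywhere to everywhere *)

Section almost_everywhere_continuous.
Context {R : realType}.

(** An interval is not a null set. *)
Lemma ae_open_itv (P : R -> Prop) (x e : R) : 0 < e ->
  (\forall t \ae (@lebesgue_measure R), P t) -> exists2 t, `|x - t| < e & P t.
Proof.
move=> e0 [A [mA A0 PA]]; apply: contrapT => nP.
have bA : ball x e `<=` A.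
  move=> t xt; apply: PA => Pt; apply: nP; exists t => //.
have mb : measurable (ball x e) by exact: measurable_ball.
have : (lebesgue_measure (ball x e) <= lebesgue_measure A)%E.
  by apply: le_measure; rewrite ?inE.
rewrite lebesgue_measure_ball ?(ltW e0)//.
by rewrite [leRHS]A0 lee_fin leNgt pmulrn_rgt0// e0.
Qed.

Context {n : nat}.
Local Notation mu := (@lebesgue_rV R n).

Lemma measurable_cube (x : 'rV[R]_n) (e : R) :
  measurable [set y : 'rV[R]_n | forall i, ball (x 0 i) e (y 0 i)].
Proof.
apply: (@measurable_box R n (fun i => ball (x 0 i) e)) => i.
exact: measurable_ball.
Qed.

Lemma lebesgue_rV_cube_gt0 (x : 'rV[R]_n) (e : R) : 0 < e ->
  (0 < mu [set y : 'rV[R]_n | forall i, ball (x 0%R i) e (y 0%R i)])%E.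
Proof.
move=> e0; have mb i : measurable (ball (x 0 i) e : set (measurableTypeR R)).
  exact: measurable_ball.
rewrite (lebesgue_rV_box mb).
elim/big_ind: _ => // [a b a0 b0|i _].
  exact: mule_gt0.
by rewrite lebesgue_measure_ball ?(ltW e0)// lte_fin pmulrn_rgt0.
Qed.

Lemma lebesgue_rV_setT_gt0 : (0 < mu [set: 'rV[R]_n])%E.
Proof.
apply: (lt_le_trans (lebesgue_rV_cube_gt0 0%R ltr01)); apply: le_measure => //.
  by rewrite inE; exact: measurable_cube.
by rewrite inE; exact: measurableT.
Qed.

(** A neighbourhood contains a cube, and cubes are not null sets. *)
Lemma ae_nbhs (P : 'rV[R]_n -> Prop) (x : 'rV[R]_n) (U : set 'rV[R]_n) :
  nbhs x U -> (\forall y \ae mu, P y) -> exists2 y, U y & P y.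
Proof.
move=> /nbhs_ballP[e /= e0 eU] [A [mA A0 PA]]; apply: contrapT => nP.
pose C := [set y : 'rV[R]_n | forall i, ball (x 0 i) e (y 0 i)].
have mC : measurable C by exact: measurable_cube.
have CA : C `<=` A.
  move=> y Cy; apply: PA => Py; apply: nP; exists y => //.
  by apply: eU; split => // i j; rewrite ord1.
have := le_measure mu (mem_set mC) (mem_set mA) CA.
by rewrite [leRHS]A0 leNgt lebesgue_rV_cube_gt0.
Qed.

Lemma ae_le_continuous (g : 'rV[R]_n -> R) (M : R) : continuous g ->
  (\forall y \ae mu, g y <= M) -> forall x, g x <= M.
Proof.
move=> cg gM x; rewrite leNgt; apply/negP => Mg.
have /ae_nbhs-/(_ _ gM)[y /=] := cg x [set r | M < r] (lt_nbhsr Mg).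
by rewrite ltNge => /negP.
Qed.

Lemma Lq_norm_infty_le (g : 'rV[R]_n -> R) (M : R) :
  (forall x, `|g x| <= M) -> (Lq_norm +oo g <= M%:E)%E.
Proof.
move=> gM; rewrite /Lq_norm unlock /= lebesgue_rV_setT_gt0.
by apply/ess_supP; apply: nearW => x /=; rewrite lee_fin.
Qed.

Lemma Lq_norm_infty_ge (g : 'rV[R]_n -> R) (M : R) : continuous g ->
  (Lq_norm +oo g <= M%:E)%E -> forall x, `|g x| <= M.
Proof.
move=> cg; rewrite /Lq_norm unlock /= lebesgue_rV_setT_gt0 => /ess_supP gM.
apply: ae_le_continuous; first by move=> x; apply: (continuous_comp (cg x)); exact: norm_continuous.
by move: gM; apply: filterS => x /=; rewrite lee_fin.
Qed.

Lemma Lq_norm1E (g : 'rV[R]_n -> R) : mu.-integrable setT (EFin \o g) ->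
  Lq_norm 1 g = (\int[mu]_x `|g x|)%:E.
Proof.
move=> ig; rewrite /Lq_norm Lnorm1 /Rintegral fineK//.
exact: integrable_fin_num (integrable_abse ig).
Qed.

Lemma ereal_gap (b : R) (T : \bar R) : (b%:E < T)%E ->
  exists2 c, b < c & (c%:E < T)%E.
Proof.
case: T => [T| |]//; rewrite ?lte_fin => bT.
  by exists ((b + T) / 2); rewrite ?lte_fin; lra.
by exists (b + 1); rewrite ?ltry// ltrDl.
Qed.

(** If |u| exceeded M at some point, then by continuity it would do so at nearby
times, which form a set of positive measure; but at almost every time the
essential bound M holds, and it is a pointwise bound since u is continuous. *)
Lemma locally_bounded_pointwise (T : \bar R) (u : R -> 'rV[R]_n -> R) (a b : R) :
  smooth_on T u -> locally_bounded_Linfty T u -> 0 < a -> a <= b -> (b%:E < T)%E ->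
  exists M, forall t x, a <= t <= b -> `|u t x| <= M.
Proof.
move=> su ub a0 ab bT; have [c bc cT] := ereal_gap bT.
have a20 : 0 < a / 2 by rewrite divr_gt0.
have a2a : a / 2 < a by rewrite ltr_pdivrMr// mulr_natr mulr2n ltrDl.
have [M uM] := ub (a / 2) c a20 (lt_trans a2a (le_lt_trans ab bc)) cT.
exists M => t x /andP[at_ tb]; rewrite leNgt; apply/negP => Mu.
have t0 : 0 < t by exact: lt_le_trans at_.
have tT : (t%:E < T)%E by apply: le_lt_trans bT; rewrite lee_fin.
have [cu _ _ _] := su.
have cun : {for (t, x), continuous (fun z : R * 'rV[R]_n => `|u z.1 z.2|)}.
  apply: (@continuous_comp _ _ _ (fun z : R * 'rV[R]_n => u z.1 z.2) Num.norm).
    exact: (cu (t, x)).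
  exact: norm_continuous.
have /nbhs_ballP[e /= e0 eP] := cun [set r | M < r] (lt_nbhsr Mu).
pose d := Num.min e (Num.min (a / 2) (c - b)).
have d0 : 0 < d by rewrite !lt_min e0 a20 subr_gt0 bc.
have [s ts us] := ae_open_itv t d0 uM.
have [de [da dc]] : d <= e /\ d <= a / 2 /\ d <= c - b.
  by rewrite /d !ge_min !lexx !orbT.
have [as_ sc] : a / 2 <= s /\ s <= c by move: ts; rewrite ltr_norml; split; lra.
have cs : continuous (u s).
  apply: (smooth_continuous su); first exact: lt_le_trans as_.
  by apply: le_lt_trans cT; rewrite lee_fin.
have := Lq_norm_infty_ge cs (us _) x.
rewrite as_ sc => /(_ isT); rewrite leNgt => /negP; apply.
apply: (eP (s, x)); split => /=; last exact: ballxx.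
exact: lt_le_trans ts de.
Qed.

End almost_everywhere_continuous.

(** * Solutions and their a priori bound *)

Section solutions.
Context {R : realType} {n : nat}.
Local Notation mu := (@lebesgue_rV R n).
Implicit Types (T : \bar R) (f : R -> R) (u v : R -> 'rV[R]_n -> R).

(** The properties of a classical solution on which the estimates rely. Bounds are
pointwise, and the continuity in L^1 is kept at time 0 only; the initial value
is the representative u 0. *)
Definition solution_on f T u : Prop :=
  [/\ smooth_on T u,
      (forall t x, cylinder T (t, x) ->
        derive1 (u ^~ x) t - laplacian (u t) x = f (u t x)),
      (forall a b : R, 0 < a -> a <= b -> (b%:E < T)%E ->
        exists M, forall t x, a <= t <= b -> `|u t x| <= M),
      (forall t : R, 0 <= t -> (t%:E < T)%E -> mu.-integrable setT (EFin \o u t)) &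
      (forall e : R, 0 < e -> exists2 s0, 0 < s0 & forall s : R, 0 < s < s0 ->
        (s%:E < T)%E -> \int[mu]_x `|u s x - u 0 x| < e)].

Lemma integrable_sub (g h : 'rV[R]_n -> R) : mu.-integrable setT (EFin \o g) ->
  mu.-integrable setT (EFin \o h) -> mu.-integrable setT (EFin \o (fun x => g x - h x)).
Proof.
move=> ig ih; have := integrableB measurableT ig ih.
by congr (_.-integrable _ _); apply/funext => x.
Qed.

Lemma integrable_norm (g : 'rV[R]_n -> R) : mu.-integrable setT (EFin \o g) ->
  mu.-integrable setT (EFin \o (fun x => `|g x|)).
Proof.
move=> ig; have := integrable_abse ig.
by congr (_.-integrable _ _); apply/funext => x.
Qed.

Lemma integrable_zero :
  mu.-integrable setT (EFin \o (fun _ : 'rV[R]_n => 0 : R)).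
Proof. rewrite (_ : EFin \o _ = cst 0%E)//; exact: integrable0. Qed.

Lemma classical_solution_on f phi T u : (0 < T)%E ->
  classical_L1_solution f phi T u -> solution_on f T u.
Proof.
move=> T0 [/C21_smooth su eq cL1 lb _].
have iu t : 0 <= t -> (t%:E < T)%E -> mu.-integrable setT (EFin \o u t).
  by move=> t0 tT; have [/Lfun1_integrable h _] := cL1 t t0 tT.
split => //.
- by move=> t x tx; rewrite (eq (t, x) tx)/=; lra.
- by move=> a b a0 ab bT; exact: locally_bounded_pointwise su lb a0 ab bT.
- move=> e e0; have [_ h] := cL1 0 (lexx _) T0.
  have hA : nbhs (0%E : \bar R) [set y : \bar R | (y < e%:E)%E].
    by apply: open_nbhs_nbhs; split; [exact: open_ereal_lt_ereal|rewrite /= lte_fin].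
  have /nbhs_ballP[s0 /= s00 sP] := h _ hA.
  exists s0 => // s /andP[s_gt0 ss0] sT.
  have bs : ball 0 s0 s by rewrite /ball/= sub0r normrN gtr0_norm.
  have := sP s bs (conj (ltW s_gt0) sT); rewrite /=.
  rewrite Lq_norm1E ?lte_fin//; apply: integrable_sub; apply: iu => //.
  exact: ltW.
Qed.

Lemma zero_solution_on f : f 0 = 0 -> solution_on f +oo%E (fun _ _ => 0).
Proof.
move=> f0; split.
- exact: smooth0.
- move=> t x _; rewrite f0 /laplacian derive1E derive_cst sub0r big1 ?oppr0// => i _.
  rewrite (_ : 'D_(vec_e i) (fun=> 0) = fun _ => 0); first exact: derive_cst.
  by apply/funext => y; exact: derive_cst.
- by move=> a b _ _ _; exists 0 => t x _; rewrite normr0.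
- by move=> t _ _; exact: integrable_zero.
- move=> e e0; exists 1 => // s _ _.
  by rewrite subrr normr0 /Rintegral integral0.
Qed.

Lemma sub_solution_on f T T' u : (T' <= T)%E -> solution_on f T u -> solution_on f T' u.
Proof.
move=> TT [[cu ut ux uxx] eq ub iu u0].
have lt t : (t%:E < T')%E -> (t%:E < T)%E by move=> h; exact: lt_le_trans TT.
have cyl (z : R * 'rV[R]_n) : cylinder T' z -> cylinder T z.
  by move=> [z0 zT]; split => //; exact: lt.
split; [split|..].
- by move=> z /cyl; exact: cu.
- by move=> t x /cyl; exact: ut.
- by move=> i t x /cyl; exact: ux.
- by move=> i t x /cyl; exact: uxx.
- by move=> t x /cyl; exact: eq.
- by move=> a b a0 ab /lt; exact: ub.
- by move=> t t0 /lt; exact: iu.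
- by move=> e /u0[s0 s00 sP]; exists s0 => // s ss /lt; exact: sP.
Qed.

Lemma heat_peak_le_powR (s : R) : 0 < s -> heat_peak n s <= s `^ (- (n%:R / 2)).
Proof.
move=> s0; rewrite /powR gt_eqF// /heat_peak ler_expR mulNr lerN2.
rewrite ler_wpM2l ?divr_ge0// ler_ln ?posrE ?mulr_gt0 ?pi_gt0//.
rewrite ler_peMl ?(ltW s0)//.
have := pi_ge2 R; lra.
Qed.

Lemma pointwise_from_heat_conv (g : 'rV[R]_n -> R) (N s : R) x :
  mu.-integrable setT (EFin \o g) -> (forall y, 0 <= g y) ->
  \int[mu]_y g y <= N -> 0 < s ->
  heat_conv g s x <= s `^ (- (n%:R / 2)) * N.
Proof.
move=> ig g0 gN s0; apply: (le_trans (heat_conv_le_peak ig g0 x s0)).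
apply: ler_pM => //; first exact/ltW/heat_peak_gt0.
  exact: Rintegral_ge0.
exact: heat_peak_le_powR.
Qed.

End solutions.

Section estimates.
Context {R : realType} {n : nat}.
Local Notation mu := (@lebesgue_rV R n).
Variable f : R -> R.
Hypotheses (n0 : (0 < n)%N)
  (f_lip : [locally [lipschitz f x | x in [set: R]]])
  (f_homo : {homo f : x y / x <= y})
  (f0 : f 0 = 0)
  (f_int : (\int[lebesgue_measure]_(s in `[1%R, +oo[)
     (s `^ (- (1 + 2 / n%:R)) * lip_const f s)%:E < +oo)%E).

Local Notation level := (@scale_level R n).
Local Notation growth := (@growth R n f).
Local Notation rate := (@growth_rate R n f).

(** The comparison function z = exp(Q) (heat kernel at time s - a + delta) * |w a|
stays below the level K (s - a + delta)^(-n/2) as long as Q <= 1, by the choice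
K = e M1. Hence the Lipschitz constant of F on [0, z] is at most kap, and z is a
supersolution of the equation with the nonlinearity F as well. The function F
stands for f, and for y |-> - f (- y), the nonlinearity satisfied by - u. *)
Lemma apriori_one_sided (T : \bar R) (w : R -> 'rV[R]_n -> R) (F : R -> R)
    (K M1 a t M : R) :
  smooth_on T w ->
  (forall t x, cylinder T (t, x) -> derive1 (w ^~ x) t - laplacian (w t) x = F (w t x)) ->
  (forall s z y, 0 <= z -> z <= y -> y <= s -> F y - F z <= lip_const f s * (y - z)) ->
  F 0 = 0 -> 0 < M1 -> K = expR 1 * M1 -> 0 < a -> a < t -> (t%:E < T)%E ->
  (forall s, 0 < s <= t -> 1 < level K s /\ growth K s < 1) ->
  (forall s x, a <= s <= t -> `|w s x| <= M) ->
  mu.-integrable setT (EFin \o w a) -> \int[mu]_x `|w a x| <= M1 ->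
  forall x, w t x <= level K (t - a).
Proof.
move=> sw eqw FL F0 M10 KE a0 at_ tT small wM iw wM1 x.
have K0 : 0 < K by rewrite KE mulr_gt0 ?expR_gt0.
have ca : continuous (w a).
  by apply: (smooth_continuous sw) => //; apply: lt_trans tT; rewrite lte_fin.
pose g x := `|w a x|.
have ig : mu.-integrable setT (EFin \o g) by exact: integrable_norm.
have cg : continuous g by move=> y; apply: (continuous_comp (ca y)); exact: norm_continuous.
have g0 y : 0 <= g y by exact: normr_ge0.
have gM y : g y <= M by apply: wM; rewrite lexx ltW.
have wg y : w a y <= g y by exact: ler_norm.
have wM' s y : a <= s <= t -> w s y <= M by move=> sab; exact: le_trans (ler_norm _) (wM s y sab).
have M0 : 0 <= M by exact: le_trans (g0 0) (gM 0).
have ta : 0 < t - a by rewrite subr_gt0.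
pose C := expR (lip_const f M * (t - a)) * (1 + sqnorm x + (2 * n%:R + 1) * (t - a)).
have C0 : 0 < C.
  rewrite mulr_gt0 ?expR_gt0// -addrA ltr_pwDl// addr_ge0 ?sqnorm_ge0//.
  by rewrite mulr_ge0 ?(ltW ta)// addr_ge0// mulr_ge0.
apply/ler_addgt0Pl => e e0.
have eta0 : 0 < e / C by rewrite divr_gt0.
have [d0 d00 dP] := heat_comparison_shift sw a0 at_ tT wM' ig cg g0 gM wg eta0.
pose d := Num.min (a / 2) (d0 / 2).
have d_gt0 : 0 < d by rewrite lt_min !divr_gt0.
have dd0 : 0 < d < d0.
  by rewrite d_gt0 gt_min [X in _ || X]ltr_pdivrMr// mulr_natr mulr2n ltrDl d00 orbT.
have da : d <= a by rewrite ge_min ler_pdivrMr// mulr_natr mulr2n lerDl (ltW a0).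
pose tm (s : R) := s - a + d.
have tm0 s : a <= s -> 0 < tm s by move=> as_; rewrite /tm ltr_wpDl// subr_ge0.
have tmt s : s <= t -> tm s <= t by rewrite /tm; lra.
pose kap s := rate K (tm s); pose Q s := growth K (tm s) - growth K d.
have cQ s : a <= s <= t -> {for s, continuous Q}.
  move=> /andP[as_ st]; apply: continuousB; last exact: cst_continuous.
  apply: (@continuous_comp R R R tm (growth K)).
    apply: continuousD; last exact: cst_continuous.
    by apply: continuousB; [exact: cvg_id|exact: cst_continuous].
  have [l1 _] := small (tm s) (introT andP (conj (tm0 s as_) (tmt s st))).
  by apply: growth_continuous => //; exact: tm0.
have Qk s s' : a <= s -> s <= s' -> s' <= t -> kap s' * (s' - s) <= Q s' - Q s.
  move=> as_ ss' s't; have as' := le_trans as_ ss'.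
  have [l1 _] := small (tm s') (introT andP (conj (tm0 s' as') (tmt s' s't))).
  have -> : Q s' - Q s = growth K (tm s') - growth K (tm s).
    by rewrite /Q opprB addrA subrK.
  have -> : s' - s = tm s' - tm s by rewrite /tm; ring.
  have tss : tm s <= tm s' by rewrite /tm; lra.
  exact: (growthB n0 f_lip f_homo f_int K0 (tm0 s as_) tss (ltW l1)).
have tma : tm a = d by rewrite /tm subrr add0r.
have Qa : Q a = 0 by rewrite /Q tma; exact: subrr.
have Q1 s : a <= s <= t -> Q s <= 1.
  move=> /andP[as_ st].
  have [_ h] := small (tm s) (introT andP (conj (tm0 s as_) (tmt s st))).
  have dt : d <= t by rewrite (le_trans da)// ltW.
  have [l1 _] := small d (introT andP (conj d_gt0 dt)).
  have gd : 0 <= growth K d by apply: growth_ge0 => //; exact: ltW.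
  rewrite /Q lerBlDr (le_trans (ltW h))// lerDl//.
have zle s y : a <= s <= t -> expR (Q s) * heat_conv g (tm s) y <= level K (tm s).
  move=> sab; have s0 := tm0 s (proj1 (andP sab)).
  rewrite /scale_level KE -mulrA; apply: ler_pM; rewrite ?expR_ge0 ?heat_conv_ge0//.
    by rewrite ler_expR Q1.
  by rewrite mulrC; exact: pointwise_from_heat_conv.
have sub s y : a < s <= t -> expR (Q s) * heat_conv g (s - a + d) y < w s y ->
    derive1 (w ^~ y) s - laplacian (w s) y <=
      kap s * (expR (Q s) * heat_conv g (s - a + d) y) +
      lip_const f M * (w s y - expR (Q s) * heat_conv g (s - a + d) y).
  move=> /andP[as_ st]; have sab : a <= s <= t by rewrite (ltW as_).
  have := zle s y sab; rewrite -/(tm s).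
  have z0 : 0 <= expR (Q s) * heat_conv g (tm s) y.
    by rewrite mulr_ge0 ?expR_ge0 ?heat_conv_ge0.
  move: z0; set z := expR _ * _ => z0 zl zw.
  rewrite eqw; last first.
    split => /=; first exact: lt_trans as_.
    by apply: le_lt_trans tT; rewrite lee_fin.
  have h1 := FL (level K (tm s)) 0 z (lexx _) z0 zl.
  have h2 := FL M z (w s y) z0 (ltW zw) (wM' s y sab).
  by move: h1 h2; rewrite F0 !subr0 /kap /growth_rate; lra.
have tab : a <= t <= t by rewrite (ltW at_) lexx.
have := dP d (lip_const f M) kap Q dd0 (lip_const_ge0 f_lip f_homo M) cQ Qk Qa sub t x tab.
rewrite (_ : expR (lip_const f M * (t - a)) * _ = e); last first.
  by rewrite mulrCA -/C divfK// gt_eqF.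
move=> /le_trans; apply; rewrite addrC lerD2l.
apply: (le_trans (zle t x tab)); apply: scale_level_homo => //.
- exact: ltW.
- by rewrite /tm; lra.
Qed.

(** The estimate of [apriori_one_sided] is uniform in the starting time a, since
K only depends on the L^1 norms near time 0. It remains to let a tend to 0. *)
Lemma apriori_bound (T : \bar R) (u : R -> 'rV[R]_n -> R) (K M1 tau : R) :
  solution_on f T u -> 0 < M1 -> K = expR 1 * M1 -> (tau%:E < T)%E ->
  (forall s, 0 < s <= tau -> 1 < level K s /\ growth K s < 1) ->
  (forall s, 0 < s <= tau -> \int[mu]_x `|u s x| <= M1) ->
  forall t x, 0 < t <= tau -> `|u t x| <= level K t.
Proof.
move=> [su eq ub iu _] M10 KE tauT small uM1 t x /andP[t0 tt].
have tT : (t%:E < T)%E by apply: le_lt_trans tauT; rewrite lee_fin.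
have key a : 0 < a -> a < t -> `|u t x| <= level K (t - a).
  move=> a0 at_; have [M uM] := ub a t a0 (ltW at_) tT.
  have aT : (a%:E < T)%E by apply: lt_trans tT; rewrite lte_fin.
  have ia := iu a (ltW a0) aT.
  have sm s : 0 < s <= t -> 1 < level K s /\ growth K s < 1.
    by move=> /andP[s0 st]; apply: small; rewrite s0 (le_trans st).
  have aM1 : \int[mu]_x `|u a x| <= M1.
    by apply: uM1; rewrite a0 (le_trans (ltW at_)).
  have up : u t x <= level K (t - a).
    apply: (apriori_one_sided su eq _ f0 M10 KE a0 at_ tT sm uM ia aM1).
    move=> s z y z0 zy ys; apply: lip_constP => //.
      by rewrite ger0_norm// (le_trans z0).
    by rewrite ger0_norm// (le_trans zy).
  have dn : 0 - u t x <= level K (t - a).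
    have s0u := smoothB (smooth0 T) su.
    have eq' s y : cylinder T (s, y) -> derive1 (fun s => 0 - u s y) s -
        laplacian (fun y => 0 - u s y) y = (fun r => - f (- r)) (0 - u s y).
      move=> sy; rewrite (heat_operatorB (smooth0 T) su sy) eq//.
      have [_ e0 _ _ _] := @zero_solution_on R n f f0.
      have sy' : cylinder +oo%E (s, y) by split; [case: sy|exact: ltry].
      by rewrite (e0 s y sy') f0 !sub0r opprK.
    apply: (@apriori_one_sided T _ (fun r => - f (- r)) K M1 a t M s0u eq' _ _ M10 KE a0 at_ tT sm).
    - move=> s z y z0 zy ys; rewrite /= opprK addrC.
      rewrite (_ : y - z = - z - - y); last by ring.
      apply: lip_constP => //; rewrite ?normrN ?lerN2//.
        by rewrite ger0_norm// (le_trans zy).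
      by rewrite ger0_norm// (le_trans z0).
    - by rewrite oppr0 f0 oppr0.
    - by move=> s y sab; rewrite sub0r normrN uM.
    - by apply: integrable_sub => //; exact: integrable_zero.
    - by under eq_Rintegral do rewrite sub0r normrN.
  by rewrite ler_norml lerNl -sub0r dn up.
have cl : (fun a => level K (t - a)) @ 0^'+ --> level K t.
  have c1 : {for 0, continuous (fun a : R => level K (t - a))}.
    apply: (@continuous_comp R R R (fun a => t - a) (level K)).
      by apply: continuousB; [exact: cst_continuous|exact: cvg_id].
    rewrite subr0; apply: continuousM; first exact: cst_continuous.
    exact: continuous_powR.
  by have := cvg_at_right_filter c1; rewrite subr0.
apply: (cvgr_to_ge cl); near=> a; apply: key.
- by near: a; exact: nbhs_right_gt.
- by near: a; exact: nbhs_right_lt.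
Unshelve. all: by end_near. Qed.

End estimates.

(** * Differences of two solutions *)

Section Rintegral_ae.
Context {R : realType} {d : measure_display} {Y : measurableType d}
  (mu : {measure set Y -> \bar R}).

Lemma ae_le_Rintegral (g h : Y -> R) :
  mu.-integrable setT (EFin \o g) -> mu.-integrable setT (EFin \o h) ->
  (forall y, 0 <= g y) -> (forall y, 0 <= h y) ->
  (\forall y \ae mu, g y <= h y) -> \int[mu]_y g y <= \int[mu]_y h y.
Proof.
move=> ig ih g0 h0 gh; rewrite -lee_fin /Rintegral !fineK; last 2 first.
- exact: integrable_fin_num ih.
- exact: integrable_fin_num ig.
apply: ae_ge0_le_integral => //.
- by move=> y _; rewrite lee_fin.
- exact: measurable_int ig.
- by move=> y _; rewrite lee_fin.
- exact: measurable_int ih.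
- by move: gh; apply: filterS => y gy _; rewrite lee_fin.
Qed.

Lemma Rintegral_le0_ae (g : Y -> R) : mu.-integrable setT (EFin \o g) ->
  (forall y, 0 <= g y) -> \int[mu]_y g y <= 0 -> \forall y \ae mu, g y = 0.
Proof.
move=> ig g0 gle.
have mg : measurable_fun setT (EFin \o g) by exact: measurable_int ig.
have : (\int[mu]_y `|(EFin \o g) y| = 0)%E.
  under eq_integral do rewrite /= ger0_norm//.
  apply/eqP; rewrite eq_le; apply/andP; split.
    by rewrite -[leLHS]fineK ?lee_fin//; exact: integrable_fin_num ig.
  by apply: integral_ge0 => y _; rewrite lee_fin.
move=> /(ae_eq_integral_abs _ measurableT mg); apply: filterS => y /(_ I) [].
by [].
Qed.

End Rintegral_ae.

Section pos_part.
Context {R : realType}.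

(** The positive part, in a form whose continuity is immediate. *)
Definition pos_part (r : R) : R := (`|r| + r) / 2.

Lemma pos_part_ge0 r : 0 <= pos_part r.
Proof. by rewrite /pos_part; have := ler_norm (- r); rewrite normrN; lra. Qed.

Lemma le_pos_part r : r <= pos_part r.
Proof. by rewrite /pos_part; have := ler_norm r; lra. Qed.

Lemma pos_part_le_norm r : pos_part r <= `|r|.
Proof. by rewrite /pos_part; have := ler_norm r; lra. Qed.

Lemma pos_part_le r s : r <= s -> 0 <= s -> pos_part r <= s.
Proof.
rewrite /pos_part => rs s0; case: (lerP 0 r) => r0.
  by rewrite ger0_norm//; lra.
by rewrite ltr0_norm//; lra.
Qed.

Lemma pos_part_continuous (V : topologicalType) (g : V -> R) : continuous g ->
  continuous (fun x => pos_part (g x)).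
Proof.
move=> cg x; suff : {for x, continuous (fun x => (`|g x| + g x) / 2)} by [].
apply: continuousM; last exact: cst_continuous.
apply: continuousD; last exact: cg.
by apply: (@continuous_comp V R R g Num.norm); [exact: cg|exact: norm_continuous].
Qed.

End pos_part.

Section differences.
Context {R : realType} {n : nat}.
Local Notation mu := (@lebesgue_rV R n).
Variable f : R -> R.
Hypotheses (n0 : (0 < n)%N)
  (f_lip : [locally [lipschitz f x | x in [set: R]]])
  (f_homo : {homo f : x y / x <= y})
  (f0 : f 0 = 0)
  (f_int : (\int[lebesgue_measure]_(s in `[1%R, +oo[)
     (s `^ (- (1 + 2 / n%:R)) * lip_const f s)%:E < +oo)%E).

Implicit Types (T : \bar R) (u v : R -> 'rV[R]_n -> R).

Lemma integrable_pos_part (g : 'rV[R]_n -> R) : mu.-integrable setT (EFin \o g) ->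
  mu.-integrable setT (EFin \o (fun x => pos_part (g x))).
Proof.
move=> ig; have mg : measurable_fun setT g by apply/measurable_EFinP/measurable_int/ig.
apply: (@le_integrable _ _ _ mu _ measurableT _ (EFin \o (fun x => `|g x|))).
- apply/measurable_EFinP; apply: measurable_funM => //; apply: measurable_funD => //.
  exact: measurableT_comp.
- move=> x _ /=; rewrite lee_fin normr_id ger0_norm ?pos_part_ge0//.
  exact: pos_part_le_norm.
- exact: integrable_norm.
Qed.

(** Where u > v the difference of the nonlinear terms is at most the Lipschitz
constant at the common bound times u - v. The majorant g of the initial difference is
either its absolute value or its positive part. *)
Lemma solution_difference T u v (g : 'rV[R]_n -> R) (lev Q : R -> R) (a t : R) :
  solution_on f T u -> solution_on f T v -> 0 < a -> a < t -> (t%:E < T)%E ->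
  (forall s x, a <= s <= t -> `|u s x| <= lev s /\ `|v s x| <= lev s) ->
  (forall s, a <= s <= t -> lev s <= lev a) ->
  (forall s, a <= s <= t -> {for s, continuous Q}) ->
  (forall s s', a <= s -> s <= s' -> s' <= t ->
     lip_const f (lev s') * (s' - s) <= Q s' - Q s) ->
  Q a = 0 ->
  mu.-integrable setT (EFin \o g) -> continuous g -> (forall x, 0 <= g x) ->
  (forall x, g x <= `|u a x - v a x|) -> (forall x, u a x - v a x <= g x) ->
  forall x, u t x - v t x <= expR (Q t) * heat_conv g (t - a) x.
Proof.
move=> [su equ ubu iu _] [sv eqv ubv iv _] a0 at_ tT uvlev levle cQ Qk Qa ig cg g0 gle wg x.
have aab : a <= a <= t by rewrite lexx ltW.
have wM s y : a <= s <= t -> u s y - v s y <= 2 * lev a.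
  move=> sab; have [h1 h2] := uvlev s y sab; have h3 := levle s sab.
  have := ler_norm (u s y); have := ler_norm (- v s y); rewrite normrN; lra.
have gM y : g y <= 2 * lev a.
  apply: (le_trans (gle y)); apply: (le_trans (ler_normB _ _)).
  by have [h1 h2] := uvlev a y aab; lra.
apply: (heat_comparison (smoothB su sv) a0 at_ tT wM ig cg g0 gM wg cQ Qk Qa).
- by exists (lip_const f (lev a)) => s sab; apply: lip_const_homo => //; exact: levle.
- move=> s y /andP[as_ st] w0.
  have sy : cylinder T (s, y).
    split => /=; first exact: lt_trans as_.
    by apply: le_lt_trans tT; rewrite lee_fin.
  rewrite (heat_operatorB su sv sy) equ// eqv//.
  have sab : a <= s <= t by rewrite (ltW as_).
  have [h1 h2] := uvlev s y sab.
  by apply: lip_constP => //; rewrite -subr_ge0 ltW.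
- by rewrite at_ lexx.
Qed.

Lemma solution_difference_L1_pos T u v (lev Q : R -> R) (a t : R) :
  solution_on f T u -> solution_on f T v -> 0 < a -> a < t -> (t%:E < T)%E ->
  (forall s x, a <= s <= t -> `|u s x| <= lev s /\ `|v s x| <= lev s) ->
  (forall s, a <= s <= t -> lev s <= lev a) ->
  (forall s, a <= s <= t -> {for s, continuous Q}) ->
  (forall s s', a <= s -> s <= s' -> s' <= t ->
     lip_const f (lev s') * (s' - s) <= Q s' - Q s) ->
  Q a = 0 ->
  \int[mu]_x pos_part (u t x - v t x) <=
    expR (Q t) * \int[mu]_x pos_part (u a x - v a x).
Proof.
move=> solu solv a0 at_ tT uvlev levle cQ Qk Qa.
have [su _ _ iu _] := solu; have [sv _ _ iv _] := solv.
have aT : (a%:E < T)%E by apply: lt_trans tT; rewrite lte_fin.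
pose g x := pos_part (u a x - v a x).
have ig : mu.-integrable setT (EFin \o g).
  by apply: integrable_pos_part; apply: integrable_sub; [apply: iu|apply: iv] => //; exact: ltW.
have cg : continuous g.
  apply: pos_part_continuous => x; apply: continuousB.
    exact: smooth_continuous su a0 aT x.
  exact: smooth_continuous sv a0 aT x.
have g0 x : 0 <= g x by exact: pos_part_ge0.
have key := solution_difference solu solv a0 at_ tT uvlev levle cQ Qk Qa ig cg g0
  (fun x => pos_part_le_norm _) (fun x => le_pos_part _).
have t0 := lt_trans a0 at_.
have it : mu.-integrable setT (EFin \o (fun x => pos_part (u t x - v t x))).
  by apply: integrable_pos_part; apply: integrable_sub; [apply: iu|apply: iv] => //; exact: ltW.
have ta : 0 < t - a by rewrite subr_gt0.
rewrite -lee_fin EFinM [(\int[mu]_x pos_part (u a x - v a x))%:E]fineK; last first.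
  exact: integrable_fin_num ig.
rewrite -/g -(integral_heat_conv ig g0 ta) -ge0_integralZl//.
- rewrite /Rintegral fineK; last exact: integrable_fin_num it.
  apply: ge0_le_integral => //.
  + by move=> x _; rewrite lee_fin pos_part_ge0.
  + exact: measurable_int it.
  + by apply/measurable_EFinP; apply: measurable_funM => //; exact: measurable_heat_conv.
  + move=> x _; rewrite -EFinM lee_fin; apply: pos_part_le; first exact: key.
    by rewrite mulr_ge0 ?expR_ge0 ?heat_conv_ge0.
- by apply/measurable_EFinP; exact: measurable_heat_conv.
- by move=> x _; rewrite lee_fin heat_conv_ge0.
Qed.

End differences.

(** * Comparison and continuous dependence *)

Section conclusions.
Context {R : realType} {n : nat}.
Local Notation mu := (@lebesgue_rV R n).
Variable f : R -> R.
Hypotheses (n0 : (0 < n)%N)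
  (f_lip : [locally [lipschitz f x | x in [set: R]]])
  (f_homo : {homo f : x y / x <= y})
  (f0 : f 0 = 0)
  (f_int : (\int[lebesgue_measure]_(s in `[1%R, +oo[)
     (s `^ (- (1 + 2 / n%:R)) * lip_const f s)%:E < +oo)%E).

Local Notation level := (@scale_level R n).
Local Notation growth := (@growth R n f).
Implicit Types (T : \bar R) (u v : R -> 'rV[R]_n -> R).

Let ball_lt_min (a b c : R) : 0 < a -> 0 < b -> 0 < c ->
  exists2 r, 0 < r & [/\ r <= a, r < b & r < c].
Proof.
move=> a0 b0 c0; exists (Num.min a (Num.min (b / 2) (c / 2))).
  by rewrite !lt_min a0 !divr_gt0.
split; rewrite ?ge_min ?gt_min ?lexx//.
  by rewrite [X in _ || (X || _)]ltr_pdivrMr// mulr_natr mulr2n ltrDl b0 orbT.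
by rewrite [X in _ || (_ || X)]ltr_pdivrMr// mulr_natr mulr2n ltrDl c0 !orbT.
Qed.

Lemma triangle_integral T u a (psi : 'rV[R]_n -> R) :
  solution_on f T u -> (0 < T)%E -> 0 < a -> (a%:E < T)%E ->
  mu.-integrable setT (EFin \o psi) ->
  \int[mu]_x `|u a x - psi x| <=
  \int[mu]_x `|u a x - u 0 x| + \int[mu]_x `|u 0 x - psi x|.
Proof.
move=> [_ _ _ iu _] T0 a0 aT ipsi.
have ia := iu a (ltW a0) aT; have i0 := iu 0 (lexx _) T0.
have i1 := integrable_norm (integrable_sub ia i0).
have i2 := integrable_norm (integrable_sub i0 ipsi).
rewrite -RintegralD//; apply: le_Rintegral => //.
- exact/integrable_norm/integrable_sub.
- have := integrableD measurableT i1 i2.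
  by congr (_.-integrable _ _); apply/funext.
- by move=> x _; rewrite (le_trans _ (ler_normD _ _))// addrA subrK.
Qed.

(** The L^1 norms of u and v are bounded near time 0 by continuity in L^1. They
determine K, and the time tau is then limited by the requirement that
[growth K] be less than 1. *)
Lemma small_time_bounds T u v : (0 < T)%E -> solution_on f T u -> solution_on f T v ->
  exists tau K, [/\ 0 < tau, (tau%:E < T)%E, 0 < K,
   (forall s, 0 < s <= tau -> 1 < level K s /\ growth K s < 1) &
   (forall s x, 0 < s <= tau -> `|u s x| <= level K s /\ `|v s x| <= level K s)].
Proof.
move=> T0 solu solv.
have [su _ _ iu u0] := solu; have [sv _ _ iv v0] := solv.
pose M1 := \int[mu]_x `|u 0 x| + \int[mu]_x `|v 0 x| + 1.
have N0 w : 0 <= \int[mu]_x `|w 0 x| by exact: Rintegral_ge0.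
have M10 : 0 < M1 by rewrite ltr_wpDl// addr_ge0.
pose K := expR 1 * M1.
have K0 : 0 < K by rewrite mulr_gt0 ?expR_gt0.
have [t0 t00 t0P] := growth_small n0 f_lip f_homo f_int K0 ltr01.
have [c c0 cT] := ereal_gap T0.
have [su0 su00 suP] := u0 1 ltr01; have [sv0 sv00 svP] := v0 1 ltr01.
have [r0 r00 [r0t r0u r0v]] := ball_lt_min t00 su00 sv00.
have [tau tau0 [tauc taur _]] := ball_lt_min c0 r00 r00.
have tauT : (tau%:E < T)%E by apply: le_lt_trans cT; rewrite lee_fin.
have small s : 0 < s <= tau -> 1 < level K s /\ growth K s < 1.
  by move=> /andP[s0 st]; apply: t0P; rewrite s0 (le_trans st)// (le_trans (ltW taur)).
have bound w s0 : solution_on f T w -> tau < s0 ->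
   (forall s : R, 0 < s < s0 -> (s%:E < T)%E -> \int[mu]_x `|w s x - w 0 x| < 1) ->
   \int[mu]_x `|w 0 x| + 1 <= M1 ->
   forall s x, 0 < s <= tau -> `|w s x| <= level K s.
  move=> solw taus wP wM1; apply: (apriori_bound n0 f_lip f_homo f0 f_int solw M10 _ tauT small) => //.
  move=> s /andP[s0' st]; apply: le_trans wM1.
  have sT : (s%:E < T)%E by apply: le_lt_trans tauT; rewrite lee_fin.
  have := triangle_integral solw T0 s0' sT (@integrable_zero R n).
  under eq_Rintegral do rewrite subr0.
  move=> /le_trans; apply; under [X in _ + X <= _]eq_Rintegral do rewrite subr0.
  rewrite addrC lerD2l ltW// wP// s0'/=; exact: le_lt_trans taus.
exists tau, K; split => // s x st; split.
- apply: (bound u su0 solu) => //; first exact: lt_trans r0u.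
  by rewrite /M1 -addrA lerD2l lerDr.
- apply: (bound v sv0 solv) => //; first exact: lt_trans r0v.
  by rewrite /M1 lerD2r lerDr.
Qed.

Section small_time.
Variables (T : \bar R) (u v : R -> 'rV[R]_n -> R) (tau K : R).
Hypotheses (solu : solution_on f T u) (solv : solution_on f T v)
  (tauT : (tau%:E < T)%E) (K0 : 0 < K)
  (small : forall s, 0 < s <= tau -> 1 < level K s /\ growth K s < 1)
  (uv_level : forall s x, 0 < s <= tau -> `|u s x| <= level K s /\ `|v s x| <= level K s).

Let time (a t s : R) : 0 < a -> t <= tau -> a <= s <= t -> 0 < s <= tau.
Proof.
by move=> a0 tt /andP[as_ st]; rewrite (lt_le_trans a0 as_) (le_trans st).
Qed.

Let Q (a s : R) := growth K s - growth K a.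

Let Q_continuous (a t s : R) : 0 < a -> t <= tau -> a <= s <= t -> {for s, continuous (Q a)}.
Proof.
move=> a0 tt st; have h := time a0 tt st; have [l1 _] := small h.
apply: continuousB; last exact: cst_continuous.
by apply: growth_continuous => //; case/andP: h.
Qed.

Let Q_rate (a t s s' : R) : 0 < a -> t <= tau -> a <= s -> s <= s' -> s' <= t ->
     lip_const f (level K s') * (s' - s) <= Q a s' - Q a s.
Proof.
move=> a0 tt as_ ss' s't.
have s't' : a <= s' <= t by rewrite (le_trans as_ ss').
have [l1 _] := small (time a0 tt s't').
have -> : Q a s' - Q a s = growth K s' - growth K s.
  by rewrite /Q opprB addrA subrK.
exact: (growthB n0 f_lip f_homo f_int K0 (lt_le_trans a0 as_) ss' (ltW l1)).
Qed.

Let Q_le (a t : R) : 0 < a -> a <= tau -> Q a t <= growth K t.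
Proof.
move=> a0 aT; rewrite /Q gerBl; apply: growth_ge0 => //.
by have [/ltW] := small (introT andP (conj a0 aT)).
Qed.

Let level_le (a t s : R) : 0 < a -> a <= s <= t -> level K s <= level K a.
Proof.
by move=> a0 /andP[as_ _]; apply: scale_level_homo => //; exact: ltW.
Qed.

Lemma small_time_heat_bound (a t : R) : 0 < a -> a < t -> t <= tau ->
  forall x, `|u t x - v t x| <=
    expR (growth K t) * heat_conv (fun y => `|u a y - v a y|) (t - a) x.
Proof.
move=> a0 at_ tt x.
have tT : (t%:E < T)%E by apply: le_lt_trans tauT; rewrite lee_fin.
have aT : (a%:E < T)%E by apply: lt_trans tT; rewrite lte_fin.
have [su _ _ iu _] := solu; have [sv _ _ iv _] := solv.
have ig : mu.-integrable setT (EFin \o (fun y => `|u a y - v a y|)).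
  by apply: integrable_norm; apply: integrable_sub; [apply: iu|apply: iv] => //; exact: ltW.
have cg : continuous (fun y => `|u a y - v a y|).
  move=> y; apply: (@continuous_comp _ _ _ (fun y => u a y - v a y) Num.norm).
    by apply: continuousB; [exact: (smooth_continuous su a0 aT)|exact: (smooth_continuous sv a0 aT)].
  exact: norm_continuous.
have lev s y : a <= s <= t -> `|u s y| <= level K s /\ `|v s y| <= level K s.
  by move=> st; apply: uv_level; exact: time st.
have lev' s y : a <= s <= t -> `|v s y| <= level K s /\ `|u s y| <= level K s.
  by move=> /(lev s y)[].
have cQ s (st : a <= s <= t) := Q_continuous a0 tt st.
have Qk s s' (h1 : a <= s) (h2 : s <= s') (h3 : s' <= t) := Q_rate a0 tt h1 h2 h3.
have Qa : Q a a = 0 by exact: subrr.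
have le s (st : a <= s <= t) := level_le a0 st.
have g0 y : 0 <= `|u a y - v a y| by [].
have dg1 y : `|u a y - v a y| <= `|v a y - u a y| by rewrite distrC.
have dg2 y : v a y - u a y <= `|u a y - v a y| by rewrite distrC ler_norm.
have up := solution_difference f_lip f_homo solu solv a0 at_ tT lev le cQ Qk Qa ig cg g0
  (fun y => lexx _) (fun y => ler_norm _) x.
have dn := solution_difference f_lip f_homo solv solu a0 at_ tT lev' le cQ Qk Qa ig cg g0
  dg1 dg2 x.
apply: (@le_trans _ _ (expR (Q a t) * heat_conv (fun y => `|u a y - v a y|) (t - a) x)).
  by rewrite ler_norml up andbT lerNl opprB.
rewrite ler_wpM2r ?heat_conv_ge0// ler_expR Q_le//.
by rewrite (le_trans (ltW at_)).
Qed.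

Lemma small_time_pos_part (a t : R) : 0 < a -> a < t -> t <= tau ->
  \int[mu]_x pos_part (u t x - v t x) <=
    expR 1 * \int[mu]_x pos_part (u a x - v a x).
Proof.
move=> a0 at_ tt.
have tT : (t%:E < T)%E by apply: le_lt_trans tauT; rewrite lee_fin.
have lev s y : a <= s <= t -> `|u s y| <= level K s /\ `|v s y| <= level K s.
  by move=> st; apply: uv_level; exact: time st.
have cQ s (st : a <= s <= t) := Q_continuous a0 tt st.
have Qk s s' (h1 : a <= s) (h2 : s <= s') (h3 : s' <= t) := Q_rate a0 tt h1 h2 h3.
have Qa : Q a a = 0 by exact: subrr.
have le s (st : a <= s <= t) := level_le a0 st.
apply: (le_trans (solution_difference_L1_pos f_lip f_homo solu solv a0 at_ tT lev le cQ Qk Qa)).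
rewrite ler_wpM2r ?ler_expR//; first by apply: Rintegral_ge0 => x _; exact: pos_part_ge0.
have t0 := lt_trans a0 at_.
apply: (le_trans (Q_le t a0 (le_trans (ltW at_) tt))).
by have [_ /ltW] := small (introT andP (conj t0 tt)).
Qed.

End small_time.

(** On a short interval the L^1 norm of the positive part of u - v is at most e
times its value at any earlier time a, which tends to 0 with a because
u 0 <= v 0. From tau on, u and v are bounded, f is Lipschitz on their range, and
the same estimate with a constant rate propagates the value 0. *)
Lemma comparison T u v : (0 < T)%E -> solution_on f T u -> solution_on f T v ->
  (\forall x \ae mu, u 0 x <= v 0 x) ->
  forall t, 0 <= t -> (t%:E < T)%E -> \forall x \ae mu, u t x <= v t x.
Proof.
move=> T0 solu solv uv0 t t_ge0 tT.
have [su _ ubu iu u0] := solu; have [sv _ ubv iv v0] := solv.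
have [tau [K [tau0 tauT K0 small uvl]]] := small_time_bounds T0 solu solv.
have ipp s : 0 <= s -> (s%:E < T)%E ->
    mu.-integrable setT (EFin \o (fun x => pos_part (u s x - v s x))).
  by move=> s0 sT; apply: integrable_pos_part; apply: integrable_sub; [exact: iu|exact: iv].
have ppae s : 0 <= s -> (s%:E < T)%E -> \int[mu]_x pos_part (u s x - v s x) <= 0 ->
    \forall x \ae mu, u s x <= v s x.
  move=> s0 sT le0; have := Rintegral_le0_ae (ipp s s0 sT) (fun x => pos_part_ge0 _) le0.
  apply: filterS => x e; rewrite -subr_le0 -e; exact: le_pos_part.
have first s : 0 < s <= tau -> \int[mu]_x pos_part (u s x - v s x) <= 0.
  move=> /andP[s0 st]; apply/ler_addgt0Pl => e e0; rewrite addr0.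
  have e20 : 0 < e / expR 1 / 2 by rewrite !divr_gt0 ?expR_gt0.
  have [ru ru0 uP] := u0 _ e20; have [rv rv0 vP] := v0 _ e20.
  have s20 : 0 < s / 2 by rewrite divr_gt0.
  have [a a0 [as_ au av]] := ball_lt_min s20 ru0 rv0.
  have ass : a < s by rewrite (le_lt_trans as_)// ltr_pdivrMr// mulr_natr mulr2n ltrDl.
  have aT : (a%:E < T)%E.
    by apply: le_lt_trans tauT; rewrite lee_fin (le_trans (ltW ass)).
  apply: (le_trans (small_time_pos_part solu solv tauT K0 small uvl a0 ass st)).
  rewrite mulrC -ler_pdivlMr ?expR_gt0//.
  have h1 := uP a (introT andP (conj a0 au)) aT.
  have h2 := vP a (introT andP (conj a0 av)) aT.
  have i1 := integrable_norm (integrable_sub (iu a (ltW a0) aT) (iu 0 (lexx _) T0)).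
  have i2 := integrable_norm (integrable_sub (iv a (ltW a0) aT) (iv 0 (lexx _) T0)).
  have isum : mu.-integrable setT (EFin \o (fun x => `|u a x - u 0 x| + `|v a x - v 0 x|)).
    by have := integrableD measurableT i1 i2; congr (_.-integrable _ _); apply/funext.
  apply: (@le_trans _ _ (\int[mu]_x (`|u a x - u 0 x| + `|v a x - v 0 x|))).
    apply: ae_le_Rintegral => //.
    - exact/ipp/aT/ltW.
    - by move=> x; exact: pos_part_ge0.
    - move: uv0; apply: filterS => x uvx; apply: pos_part_le; last by rewrite addr_ge0.
      have := ler_norm (u a x - u 0 x); have := ler_norm (- (v a x - v 0 x)).
      by rewrite normrN; lra.
  rewrite RintegralD//; lra.
have [->//|tn0] := eqVneq t 0.
have t0 : 0 < t by rewrite lt_neqAle eq_sym tn0.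
apply: ppae => //; have [tt|taut] := lerP t tau; first by apply: first; rewrite t0.
have [Mu uM] := ubu tau t tau0 (ltW taut) tT.
have [Mv vM] := ubv tau t tau0 (ltW taut) tT.
pose M := Num.max Mu Mv; pose c := lip_const f M.
have lev s x : tau <= s <= t -> `|u s x| <= (fun=> M) s /\ `|v s x| <= (fun=> M) s.
  move=> st; split; rewrite /M le_max.
    by rewrite (uM s x st).
  by rewrite (vM s x st) orbT.
have cQ s : tau <= s <= t -> {for s, continuous (fun s => c * (s - tau))}.
  move=> _; apply: continuousM; first exact: cst_continuous.
  by apply: continuousB; [exact: cvg_id|exact: cst_continuous].
have Qk s s' : tau <= s -> s <= s' -> s' <= t ->
    lip_const f ((fun=> M) s') * (s' - s) <= c * (s' - tau) - c * (s - tau).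
  by move=> _ _ _; rewrite -/c -mulrBr opprB addrA subrK.
have Qa : c * (tau - tau) = 0 by rewrite subrr mulr0.
have := solution_difference_L1_pos f_lip f_homo solu solv tau0 taut tT lev
  (fun s _ => lexx _) cQ Qk Qa.
move=> /le_trans; apply; apply: mulr_ge0_le0; first exact: expR_ge0.
by apply: first; rewrite tau0 lexx.
Qed.

End conclusions.

Section dependence.
Context {R : realType} {n : nat}.
Local Notation mu := (@lebesgue_rV R n).
Variable f : R -> R.
Hypotheses (n0 : (0 < n)%N)
  (f_lip : [locally [lipschitz f x | x in [set: R]]])
  (f_homo : {homo f : x y / x <= y})
  (f0 : f 0 = 0)
  (f_int : (\int[lebesgue_measure]_(s in `[1%R, +oo[)
     (s `^ (- (1 + 2 / n%:R)) * lip_const f s)%:E < +oo)%E).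

(** Both bounds follow from [small_time_heat_bound] at a starting time a: the L^1
bound as the heat kernel has mass one, the pointwise bound as the kernel at time
t - a is at most (t - a)^(-n/2). Then a tends to 0, and the norm of u a - v a
tends to that of u 0 - v 0. *)
Lemma continuous_dependence (T : \bar R) (u v : R -> 'rV[R]_n -> R) :
  (0 < T)%E -> solution_on f T u -> solution_on f T v ->
  exists (tau : R) (q : R -> R), [/\ 0 < tau, (tau%:E < T)%E,
    [/\ forall t, 0 < t <= tau -> {for t, continuous q},
        forall t, 0 < t <= tau -> 0 <= q t &
        q t @[t --> 0^'+] --> 0] &
    forall t, 0 < t <= tau ->
      \int[mu]_x `|u t x - v t x| <= expR (q t) * \int[mu]_x `|u 0 x - v 0 x| /\
      forall x, t `^ (n%:R / 2) * `|u t x - v t x| <=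
        expR (q t) * \int[mu]_x `|u 0 x - v 0 x|].
Proof.
move=> T0 solu solv; have [su _ _ iu u0] := solu; have [sv _ _ iv v0] := solv.
have [tau [K [tau0 tauT K0 small uvl]]] :=
  small_time_bounds n0 f_lip f_homo f0 f_int T0 solu solv.
exists tau, (growth n f K); split => //.
  split.
  - move=> t tt; have [l1 _] := small t tt.
    by apply: growth_continuous => //; case/andP: tt.
  - move=> t tt; have [l1 _] := small t tt.
    by apply: growth_ge0 => //; exact: ltW.
  - exact: growth_cvg0.
move=> t /andP[t0 tt]; set G := expR _; set N := \int[mu]_x `|u 0 x - v 0 x|.
have G0 : 0 < G by exact: expR_gt0.
have tT : (t%:E < T)%E by apply: le_lt_trans tauT; rewrite lee_fin.
have tri (p q r s : R) : `|p - q| <= `|p - r| + (`|r - s| + `|q - s|).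
  rewrite (_ : p - q = (p - r) + ((r - s) - (q - s))); last by ring.
  by rewrite (le_trans (ler_normD _ _))// lerD2l (le_trans (ler_normB _ _)).
have initial e : 0 < e -> exists2 a0, 0 < a0 & forall a, 0 < a < a0 -> a < t ->
    \int[mu]_x `|u a x - v a x| <= N + e.
  move=> e0; have e20 : 0 < e / 2 by rewrite divr_gt0.
  have [ru ru0 uP] := u0 _ e20; have [rv rv0 vP] := v0 _ e20.
  exists (Num.min ru rv); first by rewrite lt_min ru0.
  move=> a /andP[a0]; rewrite lt_min => /andP[au av] at_.
  have aT : (a%:E < T)%E by apply: lt_trans tT; rewrite lte_fin.
  have h1 := uP a (introT andP (conj a0 au)) aT.
  have h2 := vP a (introT andP (conj a0 av)) aT.
  have i1 := integrable_norm (integrable_sub (iu a (ltW a0) aT) (iu 0 (lexx _) T0)).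
  have i2 := integrable_norm (integrable_sub (iv a (ltW a0) aT) (iv 0 (lexx _) T0)).
  have i3 := integrable_norm (integrable_sub (iu 0 (lexx _) T0) (iv 0 (lexx _) T0)).
  have i4 : mu.-integrable setT (EFin \o (fun x => `|u 0 x - v 0 x| + `|v a x - v 0 x|)).
    by have := integrableD measurableT i3 i2; congr (_.-integrable _ _); apply/funext.
  have i5 : mu.-integrable setT (EFin \o (fun x => `|u a x - u 0 x| +
      (`|u 0 x - v 0 x| + `|v a x - v 0 x|))).
    by have := integrableD measurableT i1 i4; congr (_.-integrable _ _); apply/funext.
  apply: (@le_trans _ _ (\int[mu]_x (`|u a x - u 0 x| +
      (`|u 0 x - v 0 x| + `|v a x - v 0 x|)))).
    apply: le_Rintegral => //.
    apply/integrable_norm/integrable_sub; [exact/iu/aT/ltW|exact/iv/aT/ltW].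
  by rewrite RintegralD// RintegralD// -/N; lra.
have bound a := small_time_heat_bound n0 f_lip f_homo f_int solu solv tauT K0 small uvl (a := a).
have ig a : 0 < a -> a < t -> mu.-integrable setT (EFin \o (fun y => `|u a y - v a y|)).
  move=> a0 at_; have aT : (a%:E < T)%E by apply: lt_trans tT; rewrite lte_fin.
  by apply/integrable_norm/integrable_sub; [exact/iu/aT/ltW|exact/iv/aT/ltW].
have it : mu.-integrable setT (EFin \o (fun y => `|u t y - v t y|)).
  by apply/integrable_norm/integrable_sub; [exact/iu/tT/ltW|exact/iv/tT/ltW].
split.
  apply/ler_addgt0Pl => e e0.
  have eG : 0 < e / G by rewrite divr_gt0.
  have [a0 a00 aP] := initial _ eG.
  pose a := Num.min (a0 / 2) (t / 2).
  have a_gt0 : 0 < a by rewrite lt_min !divr_gt0.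
  have aa0 : a < a0 by rewrite gt_min ltr_pdivrMr// mulr_natr mulr2n ltrDl a00.
  have at_ : a < t by rewrite gt_min orbC ltr_pdivrMr// mulr_natr mulr2n ltrDl t0.
  have ta : 0 < t - a by rewrite subr_gt0.
  have g0 y : 0 <= `|u a y - v a y| by [].
  apply: (@le_trans _ _ (G * \int[mu]_x `|u a x - v a x|)); last first.
    have := aP a (introT andP (conj a_gt0 aa0)) at_.
    rewrite -(ler_pM2l G0) => /le_trans; apply.
    by rewrite mulrDr mulrCA divff ?gt_eqF// mulr1 addrC.
  rewrite -lee_fin EFinM [(\int[mu]_x `|u a x - v a x|)%:E]fineK; last first.
    exact: integrable_fin_num (ig a a_gt0 at_).
  rewrite -(integral_heat_conv (ig a a_gt0 at_) g0 ta) -ge0_integralZl//.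
  - rewrite /Rintegral fineK; last exact: integrable_fin_num it.
    apply: ge0_le_integral => //.
    + exact: measurable_int it.
    + apply/measurable_EFinP; apply: measurable_funM => //.
      by apply: measurable_heat_conv => //; exact: ig.
    + by move=> x _; rewrite -EFinM lee_fin; exact: bound.
  - by apply/measurable_EFinP; apply: measurable_heat_conv => //; exact: ig.
  - by move=> x _; rewrite lee_fin heat_conv_ge0.
  - by rewrite lee_fin ltW.
move=> x; apply/ler_addgt0Pl => e e0.
have eG : 0 < e / G by rewrite divr_gt0.
have [a0 a00 aP] := initial _ eG.
have cl : (fun a => (t - a) `^ (n%:R / 2) * `|u t x - v t x|) @ 0^'+ -->
    t `^ (n%:R / 2) * `|u t x - v t x|.
  have c1 : {for 0, continuous (fun a : R => (t - a) `^ (n%:R / 2) * `|u t x - v t x|)}.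
    apply: continuousM; last exact: cst_continuous.
    apply: (@continuous_comp R R R (fun a => t - a) (fun r => r `^ (n%:R / 2))).
      by apply: continuousB; [exact: cst_continuous|exact: cvg_id].
    by rewrite subr0; exact: continuous_powR.
  by have := cvg_at_right_filter c1; rewrite subr0.
apply: (cvgr_to_le cl); near=> a.
have a_gt0 : 0 < a by near: a; exact: nbhs_right_gt.
have aa0 : a < a0 by near: a; exact: nbhs_right_lt.
have at_ : a < t by near: a; exact: nbhs_right_lt.
have ta : 0 < t - a by rewrite subr_gt0.
have aN := aP a (introT andP (conj a_gt0 aa0)) at_.
have g0 y : 0 <= `|u a y - v a y| by [].
have h := pointwise_from_heat_conv x (ig a a_gt0 at_) g0 aN ta.
have p0 : 0 < (t - a) `^ (n%:R / 2) by exact: powR_gt0.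
have h2 := le_trans (bound a t a_gt0 at_ tt x) (ler_wpM2l (ltW G0) h).
rewrite mulrC -ler_pdivlMr//; apply: (le_trans h2).
rewrite -/G powRN mulrCA mulrC ler_pM2r ?invr_gt0//.
by rewrite mulrDr mulrCA divff ?gt_eqF// mulr1 addrC.
Unshelve. all: by end_near. Qed.

End dependence.

Lemma Rintegral_norm_ae (R : realType) (n : nat) (g h : 'rV[R]_n -> R) :
  (lebesgue_rV n).-integrable setT (EFin \o g) ->
  (lebesgue_rV n).-integrable setT (EFin \o h) ->
  (\forall x \ae lebesgue_rV n, g x = h x) ->
  \int[lebesgue_rV n]_x `|g x| = \int[lebesgue_rV n]_x `|h x|.
Proof.
move=> /integrable_norm ig /integrable_norm ih gh.
by apply/eqP; rewrite eq_le; apply/andP; split; apply: ae_le_Rintegral => //;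
  move: gh; apply: filterS => x ->.
Qed.

Theorem theorem2p6 (R : realType) (n : nat) (f : R -> R)
    (phi psi : 'rV[R]_n -> R) (Tphi Tpsi : \bar R)
    (u v : R -> 'rV[R]_n -> R) :
  (0 < n)%N ->
  [locally [lipschitz f x | x in [set: R]]] ->
  {homo f : x y / x <= y} ->
  f 0 = 0 ->
  (\int[lebesgue_measure]_(s in `[1%R, +oo[)
     (s `^ (- (1 + 2 / n%:R)) * lip_const f s)%:E < +oo)%E ->
  phi \in Lfun (lebesgue_rV n) 1%E ->
  psi \in Lfun (lebesgue_rV n) 1%E ->
  maximal_classical_L1_solution f phi Tphi u ->
  maximal_classical_L1_solution f psi Tpsi v ->
  [/\ exists (tau : R) (q : R -> R),
        [/\ 0 < tau, (tau%:E < Tphi)%E, (tau%:E < Tpsi)%E,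
            {within `]0, tau], continuous q} /\
            (forall t, 0 < t <= tau -> 0 <= q t) /\
            q t @[t --> 0^'+] --> 0 &
            forall t, 0 < t <= tau ->
              (Lq_norm 1 (u t \- v t)%R +
               (t `^ (n%:R / 2))%:E * Lq_norm +oo (u t \- v t)%R <=
               2%:E * Lq_norm 1 (phi \- psi)%R * (expR (q t))%:E)%E],
      (\forall x \ae lebesgue_rV n, phi x <= psi x) ->
        forall T : \bar R, (T <= Order.min Tphi Tpsi)%E ->
        forall t : R, 0 <= t -> (t%:E < T)%E ->
          \forall x \ae lebesgue_rV n, u t x <= v t x &
      (\forall x \ae lebesgue_rV n, 0 <= phi x) ->
        forall t : R, 0 <= t -> (t%:E < Tphi)%E ->
          \forall x \ae lebesgue_rV n, 0 <= u t x].
Proof.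
move=> n0 f_lip f_homo f0 f_int /Lfun1_integrable iphi /Lfun1_integrable ipsi
  [Tphi0 clu _ _] [Tpsi0 clv _ _].
have solu := classical_solution_on Tphi0 clu.
have solv := classical_solution_on Tpsi0 clv.
have [_ _ _ _ uphi] := clu; have [_ _ _ _ vpsi] := clv.
set T := Order.min Tphi Tpsi.
have T0 : (0 < T)%E by rewrite lt_min Tphi0.
have TTphi : (T <= Tphi)%E by rewrite ge_min lexx.
have TTpsi : (T <= Tpsi)%E by rewrite ge_min lexx orbT.
have solu' := sub_solution_on TTphi solu; have solv' := sub_solution_on TTpsi solv.
split.
- have [tau [q [tau0 tauT [cq q0 qcvg] est]]] :=
    continuous_dependence n0 f_lip f_homo f0 f_int T0 solu' solv'.
  exists tau, q; split => //.
  + exact: lt_le_trans tauT TTphi.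
  + exact: lt_le_trans tauT TTpsi.
  + split; last by [].
    apply: continuous_in_subspaceT => t; rewrite inE/= in_itv/=; exact: cq.
  move=> t tt; have [L1 Loo] := est t tt; have /andP[t0 ttau] := tt.
  have tT : (t%:E < T)%E by apply: le_lt_trans tauT; rewrite lee_fin.
  have [_ _ _ iu _] := solu'; have [_ _ _ iv _] := solv'.
  have N_eq : \int[lebesgue_rV n]_x `|u 0 x - v 0 x| =
      \int[lebesgue_rV n]_x `|phi x - psi x|.
    apply: Rintegral_norm_ae.
    - by apply: integrable_sub; [exact: iu|exact: iv].
    - exact: integrable_sub.
    - by move: vpsi; apply: filterS2 uphi => x -> ->.
  rewrite !Lq_norm1E; last 2 first.
  + exact: integrable_sub.
  + by apply: integrable_sub; [apply: iu|apply: iv] => //; exact: ltW.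
  move: L1 Loo; rewrite N_eq; set N := \int[_]_x `|phi x - psi x| => L1 Loo.
  have p0 : 0 < t `^ (n%:R / 2) by exact: powR_gt0.
  have Lq : (Lq_norm +oo (u t \- v t)%R <=
      ((t `^ (n%:R / 2))^-1 * (expR (q t) * N))%:E)%E.
    apply: Lq_norm_infty_le => x /=.
    by rewrite -(ler_pM2l p0) mulrA mulfV ?gt_eqF// mul1r.
  apply: (@le_trans _ _ ((expR (q t) * N)%:E + (expR (q t) * N)%:E)%E).
    apply: leeD; first by rewrite lee_fin.
    apply: (le_trans (lee_wpmul2l _ Lq)); first by rewrite lee_fin ltW.
    by rewrite -EFinM mulrA mulfV ?gt_eqF// mul1r.
  rewrite -EFinD -!EFinM lee_fin; lra.
- move=> phipsi T' T'T t t0 tT'.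
  apply: (comparison n0 f_lip f_homo f0 f_int T0 solu' solv') => //; last first.
    exact: lt_le_trans tT' T'T.
  by move: phipsi; apply: filterS3 uphi vpsi => x -> ->.
- move=> phi0 t t0 tT.
  apply: (comparison n0 f_lip f_homo f0 f_int Tphi0 _ solu) => //.
    by apply: sub_solution_on (zero_solution_on f0); rewrite leey.
  by move: phi0; apply: filterS2 uphi => x ->.
Qed.
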